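(* Let $\delta>0$, $p\in\mathbb{R}$, $n\ge3$, and for $j=1,\dots,n-1$ let $\lambda_{0,j}\le\lambda_{1,j}$ be real such that $\varphi_j:=\Phi_{(\lambda_{0,j},\lambda_{1,j})}$ is increasing on $[-\delta,\delta]$. Assume $$c(\delta):=\sup_{0<|h|\le\delta}\max_{1\le j\le n-1}\left|T^{(p)}_{(\lambda_{0,j},\lambda_{1,j})}(h)\right|<1.$$ Then for every partition $t_1<\dots<t_n$ with $t_{j+1}-t_j\le\delta$, the matrix $(s_{i,j})$ with $s_{i,j}=\langle H_i,H_j\rangle_p$ is row diagonally dominant (with factor $c(\delta)$), and $$\|P^{\mathcal{H}_n}\|_{op}\le\max_{t\in[t_1,t_n]}\sum_{j=1}^n|H_j(t)|\cdot\frac{\sup_{0<|h|\le\delta}\max_{1\le j\le n-1}\left|S^{(p)}_{(\lambda_{0,j},\lambda_{1,j})}(h)\right|}{1-c(\delta)}.$$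
   Context: For real $\lambda_0,\dots,\lambda_N$, the fundamental function $\Phi_{(\lambda_0,\dots,\lambda_N)}$ is the unique solution $u$ of $\prod_{j=0}^N(\frac{d}{dt}-\lambda_j)u=0$ with $u^{(k)}(0)=0$ for $0\le k\le N-1$ and $u^{(N)}(0)=1$. $T^{(p)}_{(\lambda_0,\lambda_1)}(h)=\frac12\frac{\Phi_{(\lambda_0,\lambda_1,-p-\lambda_0,-p-\lambda_1)}(h)}{\Phi_{(\lambda_0-\lambda_1,\lambda_1-\lambda_0,0,-p-\lambda_0-\lambda_1)}(h)}$ and $S^{(p)}_{(\lambda_0,\lambda_1)}(h)=\frac12\frac{\Phi_{(-\lambda_0,-\lambda_1)}(h)\Phi_{(\lambda_0,\lambda_1,-p)}(h)}{\Phi_{(\lambda_0-\lambda_1,\lambda_1-\lambda_0,0,-p-\lambda_0-\lambda_1)}(h)}$ for $h\ne0$. $H_1,\dots,H_n$ are the generalized hat functions: for $2\le j\le n-1$, $H_j(t)=\frac{\varphi_{j-1}(t-t_{j-1})}{\varphi_{j-1}(t_j-t_{j-1})}$ on $[t_{j-1},t_j]$, $H_j(t)=\frac{\varphi_j(t-t_{j+1})}{\varphi_j(t_j-t_{j+1})}$ on $[t_j,t_{j+1}]$, $0$ elsewhere; $H_1=\frac{\varphi_1(t-t_2)}{\varphi_1(t_1-t_2)}$ on $[t_1,t_2]$, $0$ elsewhere; $H_n=\frac{\varphi_{n-1}(t-t_{n-1})}{\varphi_{n-1}(t_n-t_{n-1})}$ on $[t_{n-1},t_n]$, $0$ elsewhere.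 $\mathcal{H}_n=\mathrm{span}\{H_1,\dots,H_n\}$ (the piecewise exponential splines of order 2 with frequencies $(\lambda_{0,j},\lambda_{1,j})$ on $[t_j,t_{j+1}]$). $\langle f,g\rangle_p=\int_{t_1}^{t_n}f(t)g(t)e^{pt}dt$; $P^{\mathcal{H}_n}$ is the $\langle\cdot,\cdot\rangle_p$-orthogonal projection of $C[t_1,t_n]$ onto $\mathcal{H}_n$, $\|P^{\mathcal{H}_n}\|_{op}=\sup_{f\ne0}\|P^{\mathcal{H}_n}f\|_\infty/\|f\|_\infty$. Row diagonally dominant with factor $c$: $|s_{j-1,j}|+|s_{j,j+1}|\le c|s_{j,j}|$ for all $j$, with $s_{0,1}=s_{n,n+1}=0$. *)

(* Defs.v *)
From Stdlib Require Import Reals Lra List ClassicalEpsilon.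
From Coquelicot Require Import Coquelicot.
Open Scope R_scope.

Fixpoint apply_op (ls : list R) (u : R -> R) : R -> R :=
  match ls with
  | nil => u
  | l :: ls' => fun t => Derive (apply_op ls' u) t - l * apply_op ls' u t
  end.

Definition is_fundamental (ls : list R) (u : R -> R) : Prop :=
  (forall k x, ex_derive_n u k x) /\
  (forall t, apply_op ls u t = 0) /\
  (forall k, (k < length ls - 1)%nat -> Derive_n u k 0 = 0) /\
  Derive_n u (length ls - 1) 0 = 1.

Definition Phi (ls : list R) : R -> R :=
  epsilon (inhabits (fun _ => 0)) (is_fundamental ls).

Definition Tp (p l0 l1 h : R) : R :=
  / 2 * (Phi (l0 :: l1 :: (- p - l0) :: (- p - l1) :: nil) h /
         Phi ((l0 - l1) :: (l1 - l0) :: 0 :: (- p - l0 - l1) :: nil) h).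

Definition Sp (p l0 l1 h : R) : R :=
  / 2 * (Phi ((- l0) :: (- l1) :: nil) h * Phi (l0 :: l1 :: (- p) :: nil) h /
         Phi ((l0 - l1) :: (l1 - l0) :: 0 :: (- p - l0 - l1) :: nil) h).

Definition phi (lam0 lam1 : nat -> R) (j : nat) : R -> R :=
  Phi (lam0 j :: lam1 j :: nil).

Definition hat (lam0 lam1 : nat -> R) (t : nat -> R) (n j : nat) (x : R) : R :=
  let ph := phi lam0 lam1 in
  let left := if (Nat.leb 2 j && Nat.leb j n)%bool
              then (if Rle_dec (t (j - 1)%nat) x then
                      if Rle_dec x (t j) then
                        Some (ph (j - 1)%nat (x - t (j - 1)%nat) / ph (j - 1)%nat (t j - t (j - 1)%nat))
                      else None
                    else None)
              else None in
  let right := if (Nat.leb 1 j && Nat.leb j (n - 1))%bool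
               then (if Rle_dec (t j) x then
                       if Rle_dec x (t (j + 1)%nat) then
                         Some (ph j (x - t (j + 1)%nat) / ph j (t j - t (j + 1)%nat))
                       else None
                     else None)
               else None in
  match left, right with
  | Some v, _ => v
  | None, Some v => v
  | None, None => 0
  end.

Definition ip (p a b : R) (f g : R -> R) : R :=
  RInt (fun x => f x * g x * exp (p * x)) a b.

Definition supnorm (a b : R) (f : R -> R) : R :=
  real (Lub_Rbar (fun y => exists x, a <= x <= b /\ y = Rabs (f x))).

Definition is_proj (p : R) (lam0 lam1 : nat -> R) (t : nat -> R) (n : nat)
  (f g : R -> R) : Prop :=
  (exists a : nat -> R, forall x, t 1%nat <= x <= t n ->
      g x = sum_n_m (fun j => a j * hat lam0 lam1 t n j x) 1 n) /\
  (forall i, (1 <= i <= n)%nat ->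
      ip p (t 1%nat) (t n) (fun x => f x - g x) (hat lam0 lam1 t n i) = 0).

Definition Pproj (p : R) (lam0 lam1 : nat -> R) (t : nat -> R) (n : nat)
  (f : R -> R) : R -> R :=
  epsilon (inhabits (fun _ => 0)) (is_proj p lam0 lam1 t n f).

Definition opnorm (p : R) (lam0 lam1 : nat -> R) (t : nat -> R) (n : nat) : Rbar :=
  Lub_Rbar (fun y => exists f : R -> R,
     (forall x, t 1%nat <= x <= t n -> continuous f x) /\
     supnorm (t 1%nat) (t n) f <> 0 /\
     y = supnorm (t 1%nat) (t n) (Pproj p lam0 lam1 t n f) / supnorm (t 1%nat) (t n) f).

(* Main.v *)
Require Import Defs.
From Stdlib Require Import Reals List Lra Lia ClassicalEpsilon.
From Coquelicot Require Import Coquelicot.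
Open Scope R_scope.

(** With [E mu x] the integral of [exp (mu s)] over [0, x], the order two
    fundamental function is [phi x = exp (l0 x) E (l1 - l0) x], and
    [Phi (ls ++ [mu])] solves [w' = mu w + Phi ls], [w 0 = 0]. By uniqueness every
    [Phi] in [Tp] and [Sp] becomes an explicit weighted integral, and for [k = h]
    and [k = - h] alike
      [Tp(k) = int phi(x) phi(x-k) e^(px) / (phi(k) phi(-k)) : int phi(x)^2 e^(px) / phi(k)^2],
      [Sp(k) = int phi(x) e^(px) / phi(k) : int phi(x)^2 e^(px) / phi(k)^2]
    with integrals from [0] to [k]. Hence on each mesh interval the off-diagonal
    Gram integral is at most [c] times each of the two diagonal ones, and a hat
    piece integrates to at most [S0] times its square. Summing the two intervals
    that meet at a knot gives row dominance of the tridiagonal Gram matrix and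
    [<f, H_i> <= ||f|| S0 s_ii]; the row in which the coefficient of the projection
    is largest then bounds all coefficients by [||f|| S0 / (1 - c)]. *)

(** * Linear differential operators and uniqueness of fundamental functions *)

Definition smooth (u : R -> R) : Prop := forall k x, ex_derive_n u k x.

Lemma smooth_ex_derive u x : smooth u -> ex_derive u x.
Proof. intros H; exact (H 1%nat x). Qed.

Lemma smooth_minus u v : smooth u -> smooth v -> smooth (fun x => u x - v x).
Proof.
intros Hu Hv k x; apply ex_derive_n_minus; apply filter_forall; intros y i _; auto.
Qed.

Lemma smooth_scal l u : smooth u -> smooth (fun x => l * u x).
Proof. intros Hu k x; apply (ex_derive_n_scal_l u k l x); auto. Qed.

Lemma Derive_n_Derive u k x : Derive_n (Derive u) k x = Derive_n u (S k) x.
Proof.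
change (Derive u) with (Derive_n u 1).
rewrite Derive_n_comp; f_equal; lia.
Qed.

Lemma smooth_Derive u : smooth u -> smooth (Derive u).
Proof.
intros Hu [|k] x; [exact I|].
apply ex_derive_ext with (Derive_n u (S k)).
- intros y; symmetry; apply Derive_n_Derive.
- exact (Hu (S (S k)) x).
Qed.

Lemma smooth_apply_op ls u : smooth u -> smooth (apply_op ls u).
Proof.
intros Hu; induction ls as [|l ls IH]; simpl; auto.
apply smooth_minus; [now apply smooth_Derive | now apply smooth_scal].
Qed.

Lemma apply_op_ext ls u v :
  (forall x, u x = v x) -> forall x, apply_op ls u x = apply_op ls v x.
Proof.
intros H; induction ls as [|l ls IH]; simpl; intros x; auto.
rewrite IH; f_equal; now apply Derive_ext.
Qed.

Lemma apply_op_minus ls u v x : smooth u -> smooth v ->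
  apply_op ls (fun y => u y - v y) x = apply_op ls u x - apply_op ls v x.
Proof.
intros Hu Hv; revert x; induction ls as [|l ls IH]; simpl; intros x; auto.
rewrite IH, (Derive_ext _ _ _ IH), Derive_minus; [ring | |];
  apply smooth_ex_derive; now apply smooth_apply_op.
Qed.

(** [apply_op] lets the last factor of the list act first, so a factor appended to the list can be
    peeled off next to the function itself. *)
Lemma apply_op_snoc ls mu u x :
  apply_op (ls ++ mu :: nil) u x = apply_op ls (fun y => Derive u y - mu * u y) x.
Proof.
revert x; induction ls as [|l ls IH]; simpl; intros x; auto.
rewrite IH; f_equal; now apply Derive_ext.
Qed.

(** Each factor of the operator uses up one of the derivatives known to vanish at 0, whence the
    bound on [j + length ls]. *)
Lemma Derive_n_apply_op_0 ls u m : smooth u ->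
  (forall k, (k <= m)%nat -> Derive_n u k 0 = 0) ->
  forall j, (j + length ls <= m)%nat -> Derive_n (apply_op ls u) j 0 = 0.
Proof.
intros Hu H; induction ls as [|l ls IH]; simpl; intros j Hj.
- apply H; lia.
- assert (Hs := smooth_apply_op ls u Hu).
  rewrite Derive_n_minus; try (apply filter_forall; intros y i _).
  + rewrite Derive_n_Derive, Derive_n_scal_l, !IH by lia; ring.
  + now apply smooth_Derive.
  + now apply smooth_scal.
Qed.

(** The product [exp (- l * x) * v x] has derivative zero, so it keeps the value 0 that it has at
    the origin. *)
Lemma exp_ode_zero l (v : R -> R) :
  (forall x, is_derive v x (l * v x)) -> v 0 = 0 -> forall x, v x = 0.
Proof.
intros Hd H0 x.
assert (D : forall t, is_derive (fun y => exp (- l * y) * v y) t 0).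
{ intros t; evar_last.
  - apply (is_derive_mult (fun y => exp (- l * y)) v t (- l * exp (- l * t)) (l * v t)).
    + auto_derive; auto; ring.
    + apply Hd.
    + intros; apply Rmult_comm.
  - unfold plus, mult; simpl; ring. }
assert (Hc : exp (- l * x) * v x = exp (- l * 0) * v 0).
{ destruct (Rtotal_order x 0) as [h|[->|h]]; auto; [|symmetry];
    apply (eq_is_derive (fun y => exp (- l * y) * v y)); auto; intros; apply D. }
rewrite H0, Rmult_0_r in Hc.
apply Rmult_integral in Hc; destruct Hc as [Hc|Hc]; auto.
generalize (exp_pos (- l * x)); lra.
Qed.

(** The outermost factor is peeled off: [apply_op ls u] solves [v' = l v] with [v 0 = 0], hence
    vanishes, and the induction hypothesis applies to the shorter list. *)
Lemma apply_op_zero_unique ls u : smooth u ->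
  (forall x, apply_op ls u x = 0) ->
  (forall k, (k < length ls)%nat -> Derive_n u k 0 = 0) ->
  forall x, u x = 0.
Proof.
intros Hu; induction ls as [|l ls IH]; simpl; intros H H0; auto.
assert (Hs := smooth_apply_op ls u Hu).
apply IH; [|intros k Hk; apply H0; lia].
apply (exp_ode_zero l).
- intros x; replace (l * _) with (Derive (apply_op ls u) x) by (generalize (H x); lra).
  now apply Derive_correct, smooth_ex_derive.
- apply (Derive_n_apply_op_0 ls u (length ls)) with (j := 0%nat); auto.
  intros k Hk; apply H0; lia.
Qed.

(** [Phi] is a choice by [epsilon]. One fundamental function [u] makes the chosen function
    fundamental as well, and uniqueness applies to the difference. *)
Lemma Phi_unique ls u x : ls <> nil -> is_fundamental ls u -> Phi ls x = u x.
Proof.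
intros Hn Hu.
assert (HP : is_fundamental ls (Phi ls))
  by (unfold Phi; apply epsilon_spec; now exists u).
destruct Hu as (U1 & U2 & U3 & U4), HP as (P1 & P2 & P3 & P4).
apply Rminus_diag_uniq.
apply (apply_op_zero_unique ls (fun y => Phi ls y - u y)).
- now apply smooth_minus.
- intros y; rewrite apply_op_minus; auto; rewrite U2, P2; ring.
- intros k Hk.
  rewrite Derive_n_minus by (apply filter_forall; intros; auto).
  destruct (Nat.eq_dec k (length ls - 1)) as [->|Hk'].
  + rewrite P4, U4; ring.
  + rewrite P3, U3 by lia; ring.
Qed.

(** Differentiating [w' = mu w + v] repeatedly gives the same relation between all higher
    derivatives. Hence [w] is smooth, and the prescribed initial values of [v] reappear for [w] one
    order higher. *)
Lemma is_fundamental_snoc ls mu (v w : R -> R) : ls <> nil -> is_fundamental ls v ->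
  (forall x, is_derive w x (mu * w x + v x)) -> w 0 = 0 ->
  is_fundamental (ls ++ mu :: nil) w.
Proof.
intros Hn (V1 & V2 & V3 & V4) Hw H0.
assert (A : forall k x, is_derive (Derive_n w k) x (mu * Derive_n w k x + Derive_n v k x)).
{ induction k as [|k IH]; intros x; [exact (Hw x)|].
  apply is_derive_ext with (fun y => mu * Derive_n w k y + Derive_n v k y).
  - intros y; simpl; symmetry; now apply is_derive_unique.
  - simpl; apply (is_derive_plus (fun y => mu * Derive_n w k y)).
    + apply is_derive_scal; rewrite (is_derive_unique _ _ _ (IH x)); apply IH.
    + apply Derive_correct; exact (V1 (S k) x). }
assert (B : forall k, Derive_n w (S k) 0 = mu * Derive_n w k 0 + Derive_n v k 0)
  by (intros k; simpl; now apply is_derive_unique).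
assert (L : length (ls ++ mu :: nil) = S (length ls)) by (rewrite length_app; simpl; lia).
assert (Lp : (0 < length ls)%nat) by (destruct ls; simpl; [congruence|lia]).
assert (Z : forall k, (k < length ls)%nat -> Derive_n w k 0 = 0).
{ induction k as [|k IH]; intros Hk; [exact H0|].
  rewrite B, IH, V3 by lia; ring. }
unfold is_fundamental; rewrite L; repeat split.
- intros [|k] x; [exact I|]; eexists; apply A.
- intros x; rewrite apply_op_snoc, <- (V2 x); apply apply_op_ext.
  intros y; rewrite (is_derive_unique _ _ _ (Hw y)); ring.
- intros k Hk; apply Z; lia.
- replace (S (length ls) - 1)%nat with (S (length ls - 1)) by lia.
  rewrite B, Z, V4 by lia; ring.
Qed.

Lemma is_fundamental_exp l : is_fundamental (l :: nil) (fun x => exp (l * x)).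
Proof.
assert (A : forall k x, is_derive (Derive_n (fun x => exp (l * x)) k) x
                          (l ^ (S k) * exp (l * x))).
{ induction k as [|k IH]; intros x; [simpl; auto_derive; auto; ring|].
  apply is_derive_ext with (fun y => l ^ (S k) * exp (l * y)).
  - intros y; symmetry; apply is_derive_unique, IH.
  - auto_derive; auto; simpl; ring. }
unfold is_fundamental; simpl length; repeat split.
- intros [|k] x; [exact I|]; eexists; apply A.
- intros x; simpl; rewrite (is_derive_unique (fun y : R => exp (l * y)) _ _ (A 0%nat x)); simpl; ring.
- intros k Hk; lia.
- simpl; rewrite Rmult_0_r; apply exp_0.
Qed.

(** * Explicit fundamental functions *)

Lemma is_derive_eq (f : R -> R) (x l l' : R) :
  is_derive f x l -> l = l' -> is_derive f x l'.
Proof. now intros H <-. Qed.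

(* [expint mu x] is the integral of [exp (mu * s)] over [0, x]. *)
Definition expint (mu x : R) : R :=
  if Req_EM_T mu 0 then x else (exp (mu * x) - 1) / mu.

Lemma is_derive_expint mu x : is_derive (expint mu) x (exp (mu * x)).
Proof.
unfold expint; destruct (Req_EM_T mu 0) as [->|H].
- rewrite Rmult_0_l, exp_0; apply (is_derive_id x).
- auto_derive; auto; field; auto.
Qed.

Lemma continuous_expint mu x : continuous (expint mu) x.
Proof. apply (ex_derive_continuous (expint mu)); eexists; apply is_derive_expint. Qed.

(** Trades the exponential for [expint] without dividing by [mu], so that later computations need no
    separate case [mu = 0]. *)
Lemma mul_expint mu x : mu * expint mu x = exp (mu * x) - 1.
Proof.
unfold expint; destruct (Req_EM_T mu 0) as [->|H].
- rewrite !Rmult_0_l, exp_0; ring.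
- field; auto.
Qed.

Lemma expint_0 mu : expint mu 0 = 0.
Proof.
unfold expint; destruct (Req_EM_T mu 0) as [->|H]; auto.
rewrite Rmult_0_r, exp_0; field; auto.
Qed.

(** The substitution [s = r - k] turns the integral over [[0, x - k]] into one over [[k, x]], with
    an exponential factor in front. *)
Lemma expint_sub mu x k :
  expint mu (x - k) = exp (- (mu * k)) * (expint mu x - expint mu k).
Proof.
unfold expint; destruct (Req_EM_T mu 0) as [->|H].
- rewrite Rmult_0_l, Ropp_0, exp_0; ring.
- replace (mu * (x - k)) with (mu * x + - (mu * k)) by ring.
  rewrite exp_plus.
  assert (E : exp (- (mu * k)) * exp (mu * k) = 1)
    by (rewrite <- exp_plus, Rplus_opp_l; apply exp_0).
  transitivity ((exp (mu * x) * exp (- (mu * k)) - exp (- (mu * k)) * exp (mu * k)) / mu);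
    [rewrite E | ]; field; auto.
Qed.

Lemma expint_opp mu x : expint (- mu) x = exp (- (mu * x)) * expint mu x.
Proof.
unfold expint; destruct (Req_EM_T mu 0) as [->|H].
- destruct (Req_EM_T (- 0) 0) as [_|H]; [|lra].
  rewrite Rmult_0_l, Ropp_0, exp_0; ring.
- destruct (Req_EM_T (- mu) 0) as [H'|_]; [lra|].
  replace (- mu * x) with (- (mu * x)) by ring.
  assert (E : exp (- (mu * x)) * exp (mu * x) = 1)
    by (rewrite <- exp_plus, Rplus_opp_l; apply exp_0).
  transitivity ((exp (- (mu * x)) * exp (mu * x) - exp (- (mu * x))) / mu);
    [rewrite E | ]; field; auto.
Qed.

Lemma expint_lt mu x y : x < y -> expint mu x < expint mu y.
Proof.
intros Hxy; destruct (MVT_gen (expint mu) x y (fun z => exp (mu * z))) as [z [_ Hz]].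
- intros; apply is_derive_expint.
- intros; apply continuity_pt_filterlim, continuous_expint.
- generalize (Rmult_lt_0_compat _ _ (exp_pos (mu * z)) (proj2 (Rlt_0_minus _ _) Hxy)); lra.
Qed.

(** The convolution of [exp (a x)] and [exp (b x)] over [[0, x]]; for [a = b] it is
    [x exp (a x)]. *)
Definition fund2 (a b x : R) : R := exp (a * x) * expint (b - a) x.

Lemma is_derive_fund2 a b x :
  is_derive (fund2 a b) x (b * fund2 a b x + exp (a * x)).
Proof.
unfold fund2; evar_last.
- apply (is_derive_mult (fun y => exp (a * y)) (expint (b - a)) x (a * exp (a * x))
           (exp ((b - a) * x))).
  + auto_derive; auto; ring.
  + apply is_derive_expint.
  + intros; apply Rmult_comm.
- unfold plus, mult; simpl.
  assert (H := mul_expint (b - a) x).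
  replace (exp ((b - a) * x)) with ((b - a) * expint (b - a) x + 1) by lra; ring.
Qed.

Lemma continuous_fund2 a b x : continuous (fund2 a b) x.
Proof. apply (ex_derive_continuous (fund2 a b)); eexists; apply is_derive_fund2. Qed.

Lemma fund2_0 a b : fund2 a b 0 = 0.
Proof. unfold fund2; rewrite expint_0; ring. Qed.

Lemma fund2_pos a b x : 0 < x -> 0 < fund2 a b x.
Proof.
intros H; apply Rmult_lt_0_compat; [apply exp_pos|].
rewrite <- (expint_0 (b - a)); now apply expint_lt.
Qed.

Lemma fund2_neg a b x : x < 0 -> fund2 a b x < 0.
Proof.
intros H; unfold fund2; apply (expint_lt (b - a)) in H; rewrite expint_0 in H.
generalize (Rmult_lt_0_compat _ _ (exp_pos (a * x)) (Ropp_gt_lt_0_contravar _ H)); lra.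
Qed.

Lemma fund2_neq_0 a b x : x <> 0 -> fund2 a b x <> 0.
Proof.
intros H; destruct (Rtotal_order x 0) as [h|[h|h]]; try lra.
- apply (fund2_neg a b) in h; lra.
- apply (fund2_pos a b) in h; lra.
Qed.

Lemma is_fundamental_fund2 a b : is_fundamental (a :: b :: nil) (fund2 a b).
Proof.
apply (is_fundamental_snoc (a :: nil) b (fun x => exp (a * x))); [easy|..].
- apply is_fundamental_exp.
- intros; apply is_derive_fund2.
- apply fund2_0.
Qed.

Lemma Phi2 a b x : Phi (a :: b :: nil) x = fund2 a b x.
Proof. apply Phi_unique; [easy|apply is_fundamental_fund2]. Qed.

Lemma Phi2_opp a b x : Phi (- a :: - b :: nil) x = exp (- ((a + b) * x)) * fund2 a b x.
Proof.
rewrite Phi2; unfold fund2.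
replace (- b - - a) with (- (b - a)) by ring; rewrite expint_opp.
rewrite <- !Rmult_assoc, <- !exp_plus; do 2 f_equal; ring.
Qed.

Lemma fund2_opp a b k : fund2 a b (- k) = - exp (- ((a + b) * k)) * fund2 a b k.
Proof.
unfold fund2; replace (- k) with (0 - k) at 2 by ring; rewrite expint_sub, expint_0.
replace (exp (- ((a + b) * k))) with (exp (a * - k) * exp (- ((b - a) * k)) * exp (- (a * k))).
- assert (E : exp (- (a * k)) * exp (a * k) = 1)
    by (rewrite <- exp_plus, Rplus_opp_l; apply exp_0).
  replace (a * - k) with (- (a * k)) by ring.
  transitivity (- (exp (- (a * k)) * exp (a * k)) *
                  (exp (- (a * k)) * exp (- ((b - a) * k)) * expint (b - a) k));
    [rewrite E | ]; ring.
- rewrite <- !exp_plus; f_equal; ring.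
Qed.

(** A translate solves the same second order equation, so it is a combination of [fund2 a b x] and
    [exp (a x)]. The coefficients depend on [k] only and can leave an integral over [x]. *)
Lemma fund2_sub a b x k :
  fund2 a b (x - k) = exp (- (b * k)) * (fund2 a b x - expint (b - a) k * exp (a * x)).
Proof.
unfold fund2; rewrite expint_sub.
replace (exp (- (b * k))) with (exp (- (a * k)) * exp (- ((b - a) * k)))
  by (rewrite <- exp_plus; f_equal; ring).
replace (a * (x - k)) with (a * x + - (a * k)) by ring; rewrite exp_plus; ring.
Qed.

Definition weighted_int (p : R) (f : R -> R) (k : R) : R :=
  RInt (fun x => f x * exp (p * x)) 0 k.

Lemma continuous_expweight p f x :
  continuous f x -> continuous (fun x => f x * exp (p * x)) x.
Proof.
intros H; apply (continuous_mult f (fun x => exp (p * x))); auto.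
apply (ex_derive_continuous (fun x => exp (p * x))); auto_derive; auto.
Qed.

Lemma is_derive_weighted_int p f k : (forall x, continuous f x) ->
  is_derive (weighted_int p f) k (f k * exp (p * k)).
Proof.
intros H; apply (is_derive_RInt (fun x => f x * exp (p * x)) _ 0).
- apply filter_forall; intros x; apply (RInt_correct (fun x => f x * exp (p * x))).
  apply (ex_RInt_continuous (fun x => f x * exp (p * x))); intros.
  now apply continuous_expweight.
- now apply continuous_expweight.
Qed.

Lemma is_RInt_lin (f g : R -> R) (a b If Ig u v : R) :
  is_RInt f a b If -> is_RInt g a b Ig ->
  is_RInt (fun x => u * f x + v * g x) a b (u * If + v * Ig).
Proof.
intros Hf Hg.
apply (is_RInt_plus (fun x => u * f x) (fun x => v * g x)).
- now apply (is_RInt_scal f).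
- now apply (is_RInt_scal g).
Qed.

Lemma is_RInt_eq (f g : R -> R) (a b l l' : R) : is_RInt f a b l ->
  (forall x, Rmin a b < x < Rmax a b -> f x = g x) -> l = l' -> is_RInt g a b l'.
Proof. intros H E <-; now apply is_RInt_ext with f. Qed.

Lemma RInt_correct_R (f : R -> R) (a b : R) :
  (forall x, continuous f x) -> is_RInt f a b (RInt f a b).
Proof.
intros H; apply (RInt_correct f), (ex_RInt_continuous f); auto.
Qed.

Lemma weighted_int_0 p f : weighted_int p f 0 = 0.
Proof. exact (RInt_point (V := R_CompleteNormedModule) 0 _). Qed.

(** Variation of constants: for [q = p] the last exponential is 1 and the function solves
    [w' = - p w + f], the equation asked for by [is_fundamental_snoc]. *)
Lemma is_derive_duhamel p q f x : (forall y, continuous f y) ->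
  is_derive (fun x => exp (- (q * x)) * weighted_int p f x) x
    (- q * (exp (- (q * x)) * weighted_int p f x) + exp (- ((q - p) * x)) * f x).
Proof.
intros H; evar_last.
- apply (is_derive_mult (fun y => exp (- (q * y))) (weighted_int p f) x
           (- q * exp (- (q * x))) (f x * exp (p * x))).
  + auto_derive; auto; ring.
  + now apply is_derive_weighted_int.
  + intros; apply Rmult_comm.
- unfold plus, mult; simpl.
  replace (- ((q - p) * x)) with (- (q * x) + p * x) by ring; rewrite exp_plus; ring.
Qed.

Lemma Phi3 a b p k :
  Phi (a :: b :: - p :: nil) k = exp (- (p * k)) * weighted_int p (fund2 a b) k.
Proof.
apply (Phi_unique _ (fun k => exp (- (p * k)) * weighted_int p (fund2 a b) k)); [easy|].
apply (is_fundamental_snoc (a :: b :: nil) (- p) (fund2 a b)); [easy|..].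
- apply is_fundamental_fund2.
- intros x; eapply is_derive_eq; [apply is_derive_duhamel, continuous_fund2|].
  replace (- ((p - p) * x)) with 0 by ring; rewrite exp_0; ring.
- rewrite weighted_int_0; ring.
Qed.

Lemma continuous_fund2_sq a b x : continuous (fun y : R => fund2 a b y * fund2 a b y) x.
Proof. apply (continuous_mult (fund2 a b) (fund2 a b)); apply continuous_fund2. Qed.

(** The integrand depends on the upper limit [k]. [fund2_sub] pulls this dependence out, leaving
    integrals of fixed functions; the factor [exp (a x)] that it creates joins the weight, which
    becomes [p + a]. *)
Lemma weighted_int_cross a b p k :
  weighted_int p (fun x => fund2 a b x * fund2 a b (x - k)) k =
  exp (- (b * k)) * (weighted_int p (fun y => fund2 a b y * fund2 a b y) k
                     - expint (b - a) k * weighted_int (p + a) (fund2 a b) k).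
Proof.
set (u := exp (- (b * k))); set (v := expint (b - a) k).
replace (u * _) with (u * weighted_int p (fun y => fund2 a b y * fund2 a b y) k
                      + - (u * v) * weighted_int (p + a) (fund2 a b) k) by ring.
apply is_RInt_unique.
eapply is_RInt_eq; [apply is_RInt_lin; apply RInt_correct_R; intros x; apply continuous_expweight;
  [apply continuous_fund2_sq | apply continuous_fund2] | | reflexivity].
intros x _; cbv beta; rewrite fund2_sub; fold u v.
replace ((p + a) * x) with (p * x + a * x) by ring; rewrite exp_plus; ring.
Qed.

(** Two frequencies are appended to [fund2 a b]. The first gives [exp (- ((p + a) x)) B x]; the
    second gives [w], which is the right-hand side written so that it can be differentiated in
    [k]. *)
Lemma Phi_numerator a b p k :
  Phi (a :: b :: - p - a :: - p - b :: nil) k =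
  - exp (- (p * k)) * weighted_int p (fun x => fund2 a b x * fund2 a b (x - k)) k.
Proof.
rewrite weighted_int_cross.
pose (A := weighted_int p (fun y => fund2 a b y * fund2 a b y)).
pose (B := weighted_int (p + a) (fund2 a b)).
pose (w := fun k => - exp (- ((p + b) * k)) * (A k - expint (b - a) k * B k)).
transitivity (w k).
2:{ unfold w, A, B; replace (- ((p + b) * k)) with (- (p * k) + - (b * k)) by ring.
  rewrite exp_plus; ring. }
apply Phi_unique; [easy|].
apply (is_fundamental_snoc (a :: b :: - p - a :: nil) (- p - b)
         (fun x => exp (- ((p + a) * x)) * B x)); [easy|..].
- apply (is_fundamental_snoc (a :: b :: nil) (- p - a) (fund2 a b)); [easy|..].
  + apply is_fundamental_fund2.
  + intros x; eapply is_derive_eq; [apply is_derive_duhamel, continuous_fund2|].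
    replace (- ((p + a - (p + a)) * x)) with 0 by ring; rewrite exp_0; unfold B; ring.
  + unfold B; rewrite weighted_int_0; ring.
- intros x.
  assert (dA := is_derive_weighted_int p _ x (continuous_fund2_sq a b)).
  assert (dB := is_derive_weighted_int (p + a) _ x (continuous_fund2 a b)).
  assert (dE := is_derive_expint (b - a) x).
  fold A in dA; fold B in dB; unfold w.
  auto_derive.
  + repeat split; eexists; eassumption.
  + rewrite (is_derive_unique (fun y : R => A y) _ _ dA), (is_derive_unique (fun y : R => B y) _ _ dB),
      (is_derive_unique (fun y : R => expint (b - a) y) _ _ dE).
    (* As [fund2] is [exp (a x)] times [expint], the contributions of the derivatives of [A] and [B]
       cancel; the derivative of [expint] supplies the forcing term. *)
    unfold fund2 at 1 2 3.
    replace (exp ((p + a) * x)) with (exp (p * x) * exp (a * x))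
      by (rewrite <- exp_plus; f_equal; ring).
    replace (exp (- ((p + a) * x))) with (exp (- ((p + b) * x)) * exp ((b - a) * x))
      by (rewrite <- exp_plus; f_equal; ring).
    ring.
- unfold w, A, B; rewrite expint_0, !weighted_int_0; ring.
Qed.

(** With [mu = b - a], the successive functions of the chain are [exp (- mu x)], [sinh (mu x) / mu],
    [(cosh (mu x) - 1) / mu^2] and the claimed integral. They are written through [E], which covers
    [mu = 0]. The third equals half of [exp (- ((a + b) x))] times the square of [fund2 a b x]. *)
Lemma Phi_denominator a b p k :
  Phi (a - b :: b - a :: 0 :: - p - a - b :: nil) k =
  / 2 * exp (- ((a + b + p) * k)) * weighted_int p (fun y => fund2 a b y * fund2 a b y) k.
Proof.
pose (E := expint (b - a)).
pose (A := weighted_int p (fun y => fund2 a b y * fund2 a b y)).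
assert (ME : forall x, exp ((b - a) * x) = (b - a) * E x + 1)
  by (intros x; generalize (mul_expint (b - a) x); unfold E; lra).
assert (EE : forall x, exp ((a - b) * x) * exp ((b - a) * x) = 1).
{ intros x; rewrite <- exp_plus, <- exp_0; f_equal; ring. }
apply (Phi_unique _ (fun k => / 2 * exp (- ((a + b + p) * k)) * A k)); [easy|].
apply (is_fundamental_snoc (a - b :: b - a :: 0 :: nil) (- p - a - b)
         (fun x => / 2 * exp ((a - b) * x) * (E x * E x))); [easy|..].
- apply (is_fundamental_snoc (a - b :: b - a :: nil) 0
         (fun x => / 2 * (1 + exp ((a - b) * x)) * E x)); [easy|..].
  + apply (is_fundamental_snoc (a - b :: nil) (b - a) (fun x => exp ((a - b) * x))); [easy|..].
    * apply is_fundamental_exp.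
    * intros x; assert (dE := is_derive_expint (b - a) x); fold E in dE.
      auto_derive.
      -- repeat split; eexists; eassumption.
      -- rewrite (is_derive_unique (fun y : R => E y) _ _ dE).
         generalize (ME x) (EE x); intros -> H; lra.
    * unfold E; rewrite expint_0; ring.
  + intros x; assert (dE := is_derive_expint (b - a) x); fold E in dE.
    auto_derive.
    * repeat split; eexists; eassumption.
    * rewrite (is_derive_unique (fun y : R => E y) _ _ dE).
      generalize (ME x) (f_equal (Rmult (E x)) (EE x)); intros -> H; lra.
  + unfold E; rewrite expint_0; ring.
- intros x.
  assert (dA := is_derive_weighted_int p _ x (continuous_fund2_sq a b)); fold A in dA.
  auto_derive.
  + repeat split; eexists; eassumption.
  + rewrite (is_derive_unique (fun y : R => A y) _ _ dA); unfold fund2; fold (E x).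
    replace (exp ((a - b) * x))
      with (exp (- ((a + b + p) * x)) * exp (p * x) * exp (a * x) * exp (a * x))
      by (rewrite <- !exp_plus; f_equal; ring).
    ring.
- unfold A; rewrite weighted_int_0; ring.
Qed.

(** * Integral formulas for Tp and Sp *)

Lemma RInt_eq_R (f g : R -> R) (a b : R) :
  (forall x, Rmin a b < x < Rmax a b -> f x = g x) -> RInt f a b = RInt g a b.
Proof. apply (RInt_ext (V := R_CompleteNormedModule)). Qed.

Lemma RInt_swap_R (f : R -> R) (a b : R) : (forall x, continuous f x) ->
  RInt f a b = - RInt f b a.
Proof.
intros H; symmetry; apply (opp_RInt_swap f b a), (ex_RInt_continuous f); auto.
Qed.

Lemma weighted_int_scal p (g : R -> R) c k : (forall x, continuous g x) ->
  weighted_int p (fun x => c * g x) k = c * weighted_int p g k.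
Proof.
intros H; apply is_RInt_unique.
eapply is_RInt_eq; [apply (is_RInt_scal (fun x => g x * exp (p * x)) 0 k c) | |].
- apply RInt_correct_R; intros; now apply continuous_expweight.
- intros x _; unfold scal; simpl; unfold mult; simpl; ring.
- reflexivity.
Qed.

Lemma weighted_int_shift p (g : R -> R) u v : (forall x, continuous g x) ->
  RInt (fun x => g (x - u) * exp (p * x)) u v = exp (p * u) * weighted_int p g (v - u).
Proof.
intros H; apply is_RInt_unique.
pose (f := fun y => exp (p * u) * (g y * exp (p * y))).
eapply is_RInt_eq.
- apply (is_RInt_comp_lin f 1 (- u) u v (exp (p * u) * weighted_int p g (v - u))).
  replace (1 * u + - u) with 0 by ring; replace (1 * v + - u) with (v - u) by ring.
  apply (is_RInt_scal (fun x => g x * exp (p * x)) 0 (v - u) (exp (p * u))).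
  apply RInt_correct_R; intros; now apply continuous_expweight.
- intros x _; unfold f, scal; simpl; unfold mult; simpl.
  replace (1 * x + - u) with (x - u) by ring.
  replace (p * x) with (p * u + p * (x - u)) by ring; rewrite exp_plus; ring.
- reflexivity.
Qed.

Lemma weighted_int_sq_neq_0 a b p k : k <> 0 ->
  weighted_int p (fun y => fund2 a b y * fund2 a b y) k <> 0.
Proof.
intros Hk; unfold weighted_int.
assert (P : forall x, x <> 0 -> 0 < fund2 a b x * fund2 a b x * exp (p * x)).
{ intros x Hx; apply Rmult_lt_0_compat; [|apply exp_pos].
  apply (fund2_neq_0 a b) in Hx; nra. }
assert (C : forall x, continuous (fun x => fund2 a b x * fund2 a b x * exp (p * x)) x)
  by (intros x; apply continuous_expweight, continuous_fund2_sq).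
destruct (Rdichotomy _ _ Hk).
- rewrite RInt_swap_R by auto; apply Ropp_neq_0_compat, Rgt_not_eq, RInt_gt_0; auto.
  intros; apply P; lra.
- apply Rgt_not_eq, RInt_gt_0; auto; intros; apply P; lra.
Qed.

Lemma continuous_fund2_shift a b k x : continuous (fun x : R => fund2 a b (x - k)) x.
Proof.
apply (continuous_comp (fun x => x - k) (fund2 a b)); [|apply continuous_fund2].
apply (ex_derive_continuous (fun x => x - k)); auto_derive; auto.
Qed.

(** By [fund2_opp] the factor at [- k] carries the sign and the exponential that remain in the
    quotient of [Phi_numerator] by [Phi_denominator]; the two halves cancel. *)
Lemma Tp_cross_int a b p k : k <> 0 ->
  weighted_int p (fun x => fund2 a b x * fund2 a b (x - k)) k / (fund2 a b k * fund2 a b (- k))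
  = Tp p a b k *
    (weighted_int p (fun y => fund2 a b y * fund2 a b y) k / (fund2 a b k * fund2 a b k)).
Proof.
intros Hk; unfold Tp; rewrite Phi_numerator, Phi_denominator, fund2_opp.
replace (- ((a + b + p) * k)) with (- ((a + b) * k) + - (p * k)) by ring.
rewrite exp_plus.
generalize (exp_pos (- ((a + b) * k))) (exp_pos (- (p * k))) (fund2_neq_0 a b k Hk)
  (weighted_int_sq_neq_0 a b p k Hk); intros; field; repeat split; auto; lra.
Qed.

Lemma Sp_int a b p k : k <> 0 ->
  weighted_int p (fund2 a b) k / fund2 a b k
  = Sp p a b k *
    (weighted_int p (fun y => fund2 a b y * fund2 a b y) k / (fund2 a b k * fund2 a b k)).
Proof.
intros Hk; unfold Sp; rewrite Phi2_opp, Phi3, Phi_denominator.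
replace (- ((a + b + p) * k)) with (- ((a + b) * k) + - (p * k)) by ring.
rewrite exp_plus.
generalize (exp_pos (- ((a + b) * k))) (exp_pos (- (p * k))) (fund2_neq_0 a b k Hk)
  (weighted_int_sq_neq_0 a b p k Hk); intros; field; repeat split; auto; lra.
Qed.

(** Takes the value 0 at [u] and, for [u <> v], the value 1 at [v]. Both orders of [u] and [v] are
    meant: the two hat pieces on a mesh interval are ramps with the end points exchanged. *)
Definition ramp (a b u v x : R) : R := fund2 a b (x - u) / fund2 a b (v - u).

Lemma continuous_ramp a b u v x : continuous (ramp a b u v) x.
Proof.
apply (continuous_mult (fun x => fund2 a b (x - u)) (fun _ => / fund2 a b (v - u))).
- apply continuous_fund2_shift.
- apply (continuous_const (/ fund2 a b (v - u)) x).
Qed.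

Lemma RInt_ramp_sq a b p u v :
  RInt (fun x => ramp a b u v x * ramp a b u v x * exp (p * x)) u v =
  exp (p * u) * (weighted_int p (fun y => fund2 a b y * fund2 a b y) (v - u)
                 / (fund2 a b (v - u) * fund2 a b (v - u))).
Proof.
set (k := v - u); unfold Rdiv; set (c := / (_ * _)); rewrite (Rmult_comm _ c).
rewrite <- weighted_int_scal by apply continuous_fund2_sq.
unfold k; rewrite <- weighted_int_shift.
- apply RInt_eq_R; intros x _; unfold ramp, c, Rdiv; fold k; rewrite Rinv_mult; ring.
- intros; apply (continuous_scal_r c (fun y : R => fund2 a b y * fund2 a b y)), continuous_fund2_sq.
Qed.

Lemma RInt_ramp a b p u v : u <> v ->
  RInt (fun x => ramp a b u v x * exp (p * x)) u v =
  Sp p a b (v - u) * RInt (fun x => ramp a b u v x * ramp a b u v x * exp (p * x)) u v.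
Proof.
intros Huv; rewrite RInt_ramp_sq.
replace (Sp _ _ _ _ * _) with
  (exp (p * u) * (/ fund2 a b (v - u) * weighted_int p (fund2 a b) (v - u))).
- rewrite <- weighted_int_scal by apply continuous_fund2.
  rewrite <- weighted_int_shift.
  + apply RInt_eq_R; intros x _; unfold ramp, Rdiv; ring.
  + intros; apply (continuous_scal_r (/ fund2 a b (v - u)) (fund2 a b)), continuous_fund2.
- rewrite (Rmult_comm (/ _)); fold (weighted_int p (fund2 a b) (v - u) / fund2 a b (v - u)).
  rewrite Sp_int by lra; ring.
Qed.

(** Translating [u] to the origin reduces this to [Tp_cross_int] with [k = v - u]. Exchanging [u]
    and [v] compares the same product with the square of the other ramp. *)
Lemma RInt_ramp_cross a b p u v : u <> v ->
  RInt (fun x => ramp a b u v x * ramp a b v u x * exp (p * x)) u v =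
  Tp p a b (v - u) * RInt (fun x => ramp a b u v x * ramp a b u v x * exp (p * x)) u v.
Proof.
intros Huv; rewrite RInt_ramp_sq; set (k := v - u).
assert (C : forall x, continuous (fun x : R => fund2 a b x * fund2 a b (x - k)) x).
{ intros x; apply (continuous_mult (fund2 a b) (fun x => fund2 a b (x - k))).
  - apply continuous_fund2.
  - apply continuous_fund2_shift. }
set (c := / (fund2 a b k * fund2 a b (- k))).
replace (Tp _ _ _ _ * _) with
  (exp (p * u) * (c * weighted_int p (fun x => fund2 a b x * fund2 a b (x - k)) k)).
- rewrite <- weighted_int_scal by apply C.
  unfold k at 2; rewrite <- weighted_int_shift.
  + apply RInt_eq_R; intros x _; unfold ramp, c, Rdiv.
    replace (u - v) with (- k) by (unfold k; ring).
    replace (x - u - k) with (x - v) by (unfold k; ring).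
    fold k; rewrite Rinv_mult; ring.
  + intros; apply (continuous_scal_r c (fun x : R => fund2 a b x * fund2 a b (x - k))), C.
- unfold c; rewrite (Rmult_comm (/ _)).
  fold (weighted_int p (fun x => fund2 a b x * fund2 a b (x - k)) k / (fund2 a b k * fund2 a b (- k))).
  rewrite Tp_cross_int by (unfold k; lra); ring.
Qed.

Lemma RInt_ramp_sq_pos a b p u v : u < v ->
  0 < RInt (fun x => ramp a b u v x * ramp a b u v x * exp (p * x)) u v /\
  0 < RInt (fun x => ramp a b v u x * ramp a b v u x * exp (p * x)) u v.
Proof.
intros H.
assert (C : forall w z x, continuous (fun x => ramp a b w z x * ramp a b w z x * exp (p * x)) x).
{ intros; apply continuous_expweight.
  apply (continuous_mult (ramp a b w z) (ramp a b w z)); apply continuous_ramp. }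
split; apply RInt_gt_0; auto; intros x Hx; unfold ramp;
 apply Rmult_lt_0_compat; try apply exp_pos; apply Rlt_0_sqr;
 apply Rmult_integral_contrapositive; split; try apply Rinv_neq_0_compat;
 apply fund2_neq_0; lra.
Qed.

(** * Tridiagonal systems and suprema *)

(* Forward elimination: the unknown [a m] is kept as an affine function, with slope at most 1 in absolute value, of [a (S m)]. *)
Lemma tridiagonal_solvable n (A B C b : nat -> R) :
  (forall i, (1 <= i <= n)%nat -> Rabs (A i) + Rabs (C i) < B i) ->
  exists a : nat -> R, forall i, (1 <= i <= n)%nat ->
    A i * a (i - 1)%nat + B i * a i + C i * a (i + 1)%nat = b i.
Proof.
intros H.
assert (P : forall m, (m <= n)%nat -> exists al be, Rabs be <= 1 /\
  forall y, exists a : nat -> R, a m = al + be * y /\ a (S m) = y /\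
    forall i, (1 <= i <= m)%nat ->
      A i * a (i - 1)%nat + B i * a i + C i * a (i + 1)%nat = b i).
{ induction m as [|m IH]; intros Hm.
  - exists 0, 0; split; [rewrite Rabs_R0; lra|].
    (* The fictitious unknown [a 0] is set to 0, so the elimination starts with slope 0. *)
    intros y; exists (fun i => if Nat.eqb i 1 then y else 0); simpl.
    repeat split; [ring|lia].
  - destruct IH as (al & be & Hbe & IH); [lia|].
    specialize (H (S m) ltac:(lia)).
    (* The pivot of row [S m] after [a m] has been eliminated. As [be] is at most 1 in absolute
       value, strict dominance keeps [D] above [Rabs (C (S m))], so the new slope is again at most
       1. *)
    set (D := B (S m) + A (S m) * be).
    assert (HD : Rabs (C (S m)) < D).
    { assert (Q : Rabs (A (S m) * be) <= Rabs (A (S m))).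
      { rewrite Rabs_mult; generalize (Rabs_pos (A (S m))); intros; nra. }
      generalize (Rle_abs (- (A (S m) * be))); rewrite Rabs_Ropp; unfold D; lra. }
    generalize (Rabs_pos (C (S m))); intros HC.
    exists ((b (S m) - A (S m) * al) / D), (- C (S m) / D); split.
    + unfold Rdiv; rewrite Rabs_mult, Rabs_Ropp, Rabs_inv, (Rabs_pos_eq D) by lra.
      apply Rmult_le_reg_r with D; [lra|]; field_simplify; lra.
    + intros y; set (x := (b (S m) - A (S m) * al) / D + - C (S m) / D * y).
      destruct (IH x) as (a & E1 & E2 & E3).
      exists (fun i => if Nat.eqb i (S (S m)) then y else a i); repeat split.
      * destruct (Nat.eqb_spec (S m) (S (S m))); [lia|auto].
      * now rewrite Nat.eqb_refl.
      * intros i Hi.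
        destruct (Nat.eqb_spec (i - 1) (S (S m))); [lia|].
        destruct (Nat.eqb_spec i (S (S m))); [lia|].
        destruct (Nat.eqb_spec (i + 1) (S (S m))); [|apply E3; lia].
        replace i with (S m) by lia.
        replace (S m - 1)%nat with m by lia.
        rewrite E1, E2.
        transitivity (D * x + A (S m) * al + C (S m) * y); [unfold D; ring|].
        unfold x; field; lra. }
(* The fictitious unknown [a (S n)] is set to 0. *)
destruct (P n (le_n n)) as (al & be & _ & Q); destruct (Q 0) as (a & _ & _ & E).
now exists a.
Qed.

Lemma exists_max_abs n (a : nat -> R) : (1 <= n)%nat ->
  exists i, (1 <= i <= n)%nat /\ forall j, (1 <= j <= n)%nat -> Rabs (a j) <= Rabs (a i).
Proof.
induction n as [|n IH]; intros Hn; [lia|].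
destruct (Nat.eq_dec n 0) as [->|Hn0].
- exists 1%nat; split; [lia|]; intros j Hj; replace j with 1%nat by lia; lra.
- destruct IH as (i & Hi & Hm); [lia|].
  destruct (Rle_dec (Rabs (a i)) (Rabs (a (S n)))) as [h|h].
  + exists (S n); split; [lia|]; intros j Hj.
    destruct (Nat.eq_dec j (S n)) as [->|]; [lra|].
    specialize (Hm j ltac:(lia)); lra.
  + exists i; split; [lia|]; intros j Hj.
    destruct (Nat.eq_dec j (S n)) as [->|]; [lra|apply Hm; lia].
Qed.

(** In a row [i] where [Rabs (a i)] is largest, dominance gives [B i |a i| <= K B i + c B i |a i|].
    The values [a 0] and [a (n + 1)] lie outside the range of that maximum; their coefficients [A 1]
    and [C n] are zero. *)
Lemma tridiagonal_bound n (A B C b a : nat -> R) c K : c < 1 ->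
  A 1%nat = 0 -> C n = 0 ->
  (forall i, (1 <= i <= n)%nat -> 0 < B i /\ Rabs (A i) + Rabs (C i) <= c * B i /\
     Rabs (b i) <= K * B i /\
     A i * a (i - 1)%nat + B i * a i + C i * a (i + 1)%nat = b i) ->
  forall j, (1 <= j <= n)%nat -> Rabs (a j) <= K / (1 - c).
Proof.
intros Hc HA HC H j Hj.
destruct (exists_max_abs n a ltac:(lia)) as (i & Hi & Hm).
apply Rle_trans with (Rabs (a i)); [now apply Hm|].
destruct (H i Hi) as (HB & Hd & Hb & E).
assert (QA : Rabs (A i * a (i - 1)%nat) <= Rabs (A i) * Rabs (a i)).
{ rewrite Rabs_mult; destruct (Nat.eq_dec i 1) as [->|].
  - rewrite HA, Rabs_R0; lra.
  - apply Rmult_le_compat_l; [apply Rabs_pos|apply Hm; lia]. }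
assert (QC : Rabs (C i * a (i + 1)%nat) <= Rabs (C i) * Rabs (a i)).
{ rewrite Rabs_mult; destruct (Nat.eq_dec i n) as [->|].
  - rewrite HC, Rabs_R0; lra.
  - apply Rmult_le_compat_l; [apply Rabs_pos|apply Hm; lia]. }
assert (Q : B i * Rabs (a i) <= K * B i + (Rabs (A i) + Rabs (C i)) * Rabs (a i)).
{ rewrite <- (Rabs_pos_eq (B i)) at 1 by lra; rewrite <- Rabs_mult.
  replace (B i * a i) with (b i - A i * a (i - 1)%nat - C i * a (i + 1)%nat) by lra.
  generalize (Rabs_triang (b i - A i * a (i - 1)%nat) (- (C i * a (i + 1)%nat)))
    (Rabs_triang (b i) (- (A i * a (i - 1)%nat))).
  rewrite !Rabs_Ropp; unfold Rminus; lra. }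
assert (Q' := Rmult_le_compat_r _ _ _ (Rabs_pos (a i)) Hd).
apply Rmult_le_reg_r with (B i * (1 - c)); [apply Rmult_lt_0_compat; lra|].
replace (K / (1 - c) * (B i * (1 - c))) with (K * B i) by (field; lra).
lra.
Qed.

Lemma sum_n_m_eq_0 (u : nat -> R) n :
  (forall j, (1 <= j <= n)%nat -> u j = 0) -> sum_n_m u 1 n = 0.
Proof.
intros H; transitivity (sum_n_m (fun _ : nat => zero : R_AbelianMonoid) 1 n).
- now apply (sum_n_m_ext_loc (G := R_AbelianMonoid)).
- apply (sum_n_m_const_zero (G := R_AbelianMonoid)).
Qed.

Lemma sum_n_m_two (u : nat -> R) n k : (1 <= k)%nat -> (k + 1 <= n)%nat ->
  (forall j, (1 <= j <= n)%nat -> j <> k -> j <> (k + 1)%nat -> u j = 0) ->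
  sum_n_m u 1 n = u k + u (k + 1)%nat.
Proof.
intros Hk; induction n as [|n IH]; intros Hn H; [lia|].
rewrite sum_n_Sm by lia; unfold plus; simpl.
destruct (Nat.eq_dec (k + 1) (S n)) as [E|E].
- rewrite E; f_equal; destruct n as [|n]; [lia|].
  rewrite sum_n_Sm by lia; unfold plus; simpl.
  rewrite sum_n_m_eq_0 by (intros; apply H; lia).
  replace (S n) with k by lia; ring.
- rewrite IH, (H (S n)) by first [lia | intros; apply H; lia]; ring.
Qed.

(** [real] sends infinite values to 0, so finiteness has to be known before [real (Lub_Rbar E)] can
    be used as a supremum. *)
Lemma Lub_Rbar_le_real (E : R -> Prop) K : (exists y, E y) -> (forall y, E y -> y <= K) ->
  is_finite (Lub_Rbar E) /\ real (Lub_Rbar E) <= K /\ forall y, E y -> y <= real (Lub_Rbar E).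
Proof.
intros [y0 Hy0] H; destruct (Lub_Rbar_correct E) as [U L].
assert (LK : Rbar_le (Lub_Rbar E) K) by (apply L; intros y Hy; exact (H y Hy)).
assert (U0 := U y0 Hy0).
destruct (Lub_Rbar E) as [l| |]; simpl in *; easy.
Qed.

Lemma supnorm_le a b f K : a <= b -> (forall x, a <= x <= b -> Rabs (f x) <= K) ->
  supnorm a b f <= K.
Proof.
intros Hab H; apply Lub_Rbar_le_real.
- exists (Rabs (f a)), a; split; auto; lra.
- intros y (x & Hx & ->); auto.
Qed.

Lemma le_supnorm a b f x : (forall y, a <= y <= b -> continuous f y) -> a <= x <= b ->
  Rabs (f x) <= supnorm a b f.
Proof.
intros H Hx.
destruct (continuity_ab_maj (fun y => Rabs (f y)) a b) as (M & HM & _); [lra| |].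
- intros y Hy; apply continuity_pt_filterlim.
  apply (continuous_comp f Rabs); [now apply H|apply continuous_Rabs].
- apply (Lub_Rbar_le_real (fun y => exists x, a <= x <= b /\ y = Rabs (f x)) (Rabs (f M))).
  + now exists (Rabs (f x)), x.
  + intros y (z & Hz & ->); auto.
  + now exists x.
Qed.

(** * Hat functions *)

Definition increasing_knots (t : nat -> R) (n : nat) : Prop :=
  forall k, (1 <= k <= n - 1)%nat -> t k < t (k + 1)%nat.

Lemma knots_le t n i j : increasing_knots t n -> (1 <= i)%nat -> (i <= j)%nat -> (j <= n)%nat ->
  t i <= t j.
Proof.
intros H Hi Hij; induction Hij as [|j Hij IH]; intros Hj; [lra|].
specialize (H j ltac:(lia)); replace (j + 1)%nat with (S j) in H by lia.
specialize (IH ltac:(lia)); lra.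
Qed.

(** On the mesh interval from [t k] to [t (k + 1)], [lramp] is the rising piece of hat [k + 1], and
    [rramp] is the falling piece of hat [k]. *)
Definition lramp (lam0 lam1 t : nat -> R) (k : nat) : R -> R :=
  ramp (lam0 k) (lam1 k) (t k) (t (k + 1)%nat).

Definition rramp (lam0 lam1 t : nat -> R) (k : nat) : R -> R :=
  ramp (lam0 k) (lam1 k) (t (k + 1)%nat) (t k).

Lemma phi_ratio lam0 lam1 k x y :
  phi lam0 lam1 k x / phi lam0 lam1 k y =
  fund2 (lam0 k) (lam1 k) x / fund2 (lam0 k) (lam1 k) y.
Proof. unfold phi; now rewrite !Phi2. Qed.

Lemma hat_left lam0 lam1 t n k x : (1 <= k <= n - 1)%nat -> t k <= x <= t (k + 1)%nat ->
  hat lam0 lam1 t n (k + 1) x = lramp lam0 lam1 t k x.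
Proof.
intros Hk Hx; unfold hat; replace (k + 1 - 1)%nat with k by lia.
assert (E : (Nat.leb 2 (k + 1) && Nat.leb (k + 1) n)%bool = true)
  by (apply andb_true_intro; split; apply Nat.leb_le; lia).
rewrite E; destruct (Rle_dec (t k) x); [|lra].
destruct (Rle_dec x (t (k + 1)%nat)); [|lra].
apply phi_ratio.
Qed.

(** The left end is excluded because [hat] consults its left branch first, and at [t k] that branch
    may apply. *)
Lemma hat_right lam0 lam1 t n k x : (1 <= k <= n - 1)%nat -> t k < x <= t (k + 1)%nat ->
  hat lam0 lam1 t n k x = rramp lam0 lam1 t k x.
Proof.
intros Hk Hx; unfold hat.
assert (E : (Nat.leb 1 k && Nat.leb k (n - 1))%bool = true)
  by (apply andb_true_intro; split; apply Nat.leb_le; lia).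
rewrite E; destruct (Rle_dec (t k) x); [|lra].
destruct (Rle_dec x (t k)); [lra|].
destruct (Rle_dec x (t (k + 1)%nat)); [|lra].
clear E; destruct (Nat.leb 2 k && Nat.leb k n)%bool; [destruct (Rle_dec (t (k - 1)%nat) x)|];
  apply phi_ratio.
Qed.

Lemma hat_zero lam0 lam1 t n j x :
  ((2 <= j)%nat -> x < t (j - 1)%nat \/ t j < x) ->
  ((j <= n - 1)%nat -> x < t j \/ t (j + 1)%nat < x) ->
  hat lam0 lam1 t n j x = 0.
Proof.
intros Hl Hr; unfold hat.
destruct (Nat.leb_spec 2 j); destruct (Nat.leb_spec j n); destruct (Nat.leb_spec 1 j);
  destruct (Nat.leb_spec j (n - 1)); simpl; auto;
  try specialize (Hl ltac:(assumption)); try specialize (Hr ltac:(assumption));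
  repeat match goal with
  | |- context [Rle_dec ?a ?b] => destruct (Rle_dec a b); try lra
  end.
Qed.

Lemma hat_zero_piece lam0 lam1 t n j k x : increasing_knots t n ->
  (1 <= j <= n)%nat -> (1 <= k <= n - 1)%nat -> j <> k -> j <> (k + 1)%nat ->
  t k < x < t (k + 1)%nat -> hat lam0 lam1 t n j x = 0.
Proof.
intros Ht Hj Hk H1 H2 Hx.
destruct (Nat.lt_ge_cases j k) as [h|h].
- assert (Q1 := knots_le t n j k Ht ltac:(lia) ltac:(lia) ltac:(lia)).
  assert (Q2 := knots_le t n (j + 1) k Ht ltac:(lia) ltac:(lia) ltac:(lia)).
  apply hat_zero; intros; right; lra.
- assert (Q1 := knots_le t n (k + 1) j Ht ltac:(lia) ltac:(lia) ltac:(lia)).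
  assert (Q2 := knots_le t n (k + 1) (j - 1) Ht ltac:(lia) ltac:(lia) ltac:(lia)).
  apply hat_zero; intros; left; lra.
Qed.

Lemma sum_hat_piece lam0 lam1 t n (a : nat -> R) k x : increasing_knots t n ->
  (1 <= k <= n - 1)%nat -> t k < x < t (k + 1)%nat ->
  sum_n_m (fun j => a j * hat lam0 lam1 t n j x) 1 n =
  a k * rramp lam0 lam1 t k x + a (k + 1)%nat * lramp lam0 lam1 t k x.
Proof.
intros Ht Hk Hx; rewrite (sum_n_m_two _ n k) by
  first [lia | intros; rewrite (hat_zero_piece _ _ _ _ _ k) by (auto; lia); ring].
rewrite hat_right, hat_left by (auto; lra); reflexivity.
Qed.

(** A piece is a quotient [phi y / phi h] with [y] between 0 and [h], and [phi] is increasing with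
    [phi 0 = 0]. The bound makes the supremum of the sum of the absolute hats finite. *)
Lemma Rabs_hat_le_1 delta lam0 lam1 t n j x :
  (forall k, (1 <= k <= n - 1)%nat -> forall x y, - delta <= x -> x < y -> y <= delta ->
       phi lam0 lam1 k x < phi lam0 lam1 k y) ->
  (forall k, (1 <= k <= n - 1)%nat -> t k < t (k + 1)%nat /\ t (k + 1)%nat - t k <= delta) ->
  Rabs (hat lam0 lam1 t n j x) <= 1.
Proof.
intros Hphi Ht.
assert (P0 : forall k, phi lam0 lam1 k 0 = 0) by (intros; unfold phi; rewrite Phi2; apply fund2_0).
assert (Z : Rabs 0 <= 1) by (rewrite Rabs_R0; lra).
assert (Q : forall k y h, (1 <= k <= n - 1)%nat -> h <> 0 -> Rabs h <= delta ->
   0 <= y <= h \/ h <= y <= 0 -> Rabs (phi lam0 lam1 k y / phi lam0 lam1 k h) <= 1).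
{ intros k y h Hk Hh Hd Hy.
  unfold Rdiv; rewrite Rabs_mult, Rabs_inv.
  assert (M : forall u v, - delta <= u -> u <= v -> v <= delta ->
    phi lam0 lam1 k u <= phi lam0 lam1 k v).
  { intros u v Hu [Huv| ->] Hv; [left; now apply Hphi|lra]. }
  assert (N : 0 < Rabs (phi lam0 lam1 k h))
    by (apply Rabs_pos_lt; unfold phi; rewrite Phi2; now apply fund2_neq_0).
  apply Rmult_le_reg_r with (Rabs (phi lam0 lam1 k h)); auto.
  rewrite Rmult_assoc, Rinv_l, Rmult_1_l, Rmult_1_r by lra.
  generalize (P0 k); intros E; apply Rabs_le_between in Hd.
  destruct Hy as [Hy|Hy].
  - generalize (M 0 y) (M y h); intros; rewrite !Rabs_pos_eq by lra; lra.
  - generalize (M y 0) (M h y); intros; rewrite !Rabs_left1 by lra; lra. }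
unfold hat.
destruct (Nat.leb_spec 2 j); destruct (Nat.leb_spec j n); destruct (Nat.leb_spec 1 j);
  destruct (Nat.leb_spec j (n - 1)); simpl; auto; try lia;
  repeat match goal with
  | |- context [Rle_dec ?a ?b] => destruct (Rle_dec a b)
  end; auto;
  first [ generalize (Ht (j - 1)%nat ltac:(lia)); replace (j - 1 + 1)%nat with j by lia; intros;
          apply Q; [lia | lra | rewrite Rabs_pos_eq; lra | lra]
        | generalize (Ht j ltac:(lia)); intros;
          apply Q; [lia | lra | rewrite Rabs_left1; lra | lra] ].
Qed.

(** * Gram matrix *)

Lemma is_RInt_zero (f : R -> R) (a b : R) : a <= b ->
  (forall x, a < x < b -> f x = 0) -> is_RInt f a b 0.
Proof.
intros Hab H; apply is_RInt_eq with (fun _ => 0) ((b - a) * 0).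
- apply (is_RInt_const a b 0).
- intros x; rewrite Rmin_left, Rmax_right by lra; intros Hx; now rewrite H.
- ring.
Qed.

(** [lI] and [rI] are the contributions of the mesh intervals to the left and right of knot [i]; at
    an end knot the missing one is 0. *)
Lemma is_RInt_hat p lam0 lam1 t n i (F : R -> R) lI rI :
  increasing_knots t n -> (1 <= i <= n)%nat ->
  (i = 1%nat -> lI = 0) -> (i = n -> rI = 0) ->
  (forall k, i = (k + 1)%nat -> (1 <= k <= n - 1)%nat ->
     is_RInt (fun x => F x * lramp lam0 lam1 t k x * exp (p * x)) (t k) (t (k + 1)%nat) lI) ->
  ((i <= n - 1)%nat ->
     is_RInt (fun x => F x * rramp lam0 lam1 t i x * exp (p * x)) (t i) (t (i + 1)%nat) rI) ->
  is_RInt (fun x => F x * hat lam0 lam1 t n i x * exp (p * x)) (t 1%nat) (t n) (lI + rI).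
Proof.
intros Ht Hi El Er Hl Hr.
apply (is_RInt_Chasles (fun x => F x * hat lam0 lam1 t n i x * exp (p * x)) (t 1%nat) (t i)).
- destruct (Nat.eq_dec i 1) as [->|Hi1].
  + rewrite El by auto; apply (is_RInt_point (V := R_NormedModule)).
  + destruct i as [|k]; [lia|]; replace (S k) with (k + 1)%nat in * by lia.
    assert (Hk : (1 <= k <= n - 1)%nat) by lia.
    assert (Hkt := Ht k Hk).
    replace lI with (0 + lI) by ring.
    apply (is_RInt_Chasles
      (fun x => F x * hat lam0 lam1 t n (k + 1) x * exp (p * x)) (t 1%nat) (t k)).
    * apply is_RInt_zero; [apply (knots_le t n); auto; lia|].
      intros x Hx; rewrite hat_zero; [ring|..]; intros; left;
        replace (k + 1 - 1)%nat with k by lia; lra.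
    * eapply is_RInt_eq; [apply (Hl k); auto| |reflexivity].
      intros x; rewrite Rmin_left, Rmax_right by lra; intros Hx.
      now rewrite hat_left by (auto; lra).
- destruct (Nat.eq_dec i n) as [->|Hin].
  + rewrite Er by auto; apply (is_RInt_point (V := R_NormedModule)).
  + assert (Hk : (1 <= i <= n - 1)%nat) by lia.
    assert (Hkt := Ht i Hk).
    replace rI with (rI + 0) by ring.
    apply (is_RInt_Chasles
      (fun x => F x * hat lam0 lam1 t n i x * exp (p * x)) (t i) (t (i + 1)%nat)).
    * eapply is_RInt_eq; [apply Hr; lia| |reflexivity].
      intros x; rewrite Rmin_left, Rmax_right by lra; intros Hx.
      now rewrite hat_right by (auto; lra).
    * apply is_RInt_zero; [apply (knots_le t n); auto; lia|].
      intros x Hx; rewrite hat_zero; [ring|..]; intros; right; lra.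
Qed.

Definition piece (p : R) (t : nat -> R) (k : nat) (F : R -> R) : R :=
  RInt (fun x => F x * exp (p * x)) (t k) (t (k + 1)%nat).

Definition gramC p lam0 lam1 t k :=
  piece p t k (fun x => lramp lam0 lam1 t k x * rramp lam0 lam1 t k x).
Definition gramL p lam0 lam1 t k :=
  piece p t k (fun x => lramp lam0 lam1 t k x * lramp lam0 lam1 t k x).
Definition gramR p lam0 lam1 t k :=
  piece p t k (fun x => rramp lam0 lam1 t k x * rramp lam0 lam1 t k x).

(** Row [i] of the normal equations collects interval [i - 1] on the left of knot [i] and interval
    [i] on its right. The tests drop the interval missing at either end; [load] is the right-hand
    side. *)
Definition lower p lam0 lam1 t i : R :=
  if Nat.eqb i 1 then 0 else gramC p lam0 lam1 t (i - 1).
Definition upper p lam0 lam1 t (n i : nat) : R :=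
  if Nat.eqb i n then 0 else gramC p lam0 lam1 t i.
Definition diag p lam0 lam1 t (n i : nat) : R :=
  (if Nat.eqb i 1 then 0 else gramL p lam0 lam1 t (i - 1)) +
  (if Nat.eqb i n then 0 else gramR p lam0 lam1 t i).
Definition load p lam0 lam1 t (n : nat) (f : R -> R) (i : nat) : R :=
  (if Nat.eqb i 1 then 0 else
     piece p t (i - 1) (fun x => f x * lramp lam0 lam1 t (i - 1) x)) +
  (if Nat.eqb i n then 0 else piece p t i (fun x => f x * rramp lam0 lam1 t i x)).

Lemma continuous_lramp lam0 lam1 t k x : continuous (lramp lam0 lam1 t k) x.
Proof. apply continuous_ramp. Qed.

Lemma continuous_rramp lam0 lam1 t k x : continuous (rramp lam0 lam1 t k) x.
Proof. apply continuous_ramp. Qed.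

Lemma is_RInt_piece p t k (F : R -> R) : t k <= t (k + 1)%nat ->
  (forall x, t k <= x <= t (k + 1)%nat -> continuous F x) ->
  is_RInt (fun x => F x * exp (p * x)) (t k) (t (k + 1)%nat) (piece p t k F).
Proof.
intros Ht H; apply (RInt_correct (fun x => F x * exp (p * x))).
apply (ex_RInt_continuous (fun x => F x * exp (p * x))).
intros x; rewrite Rmin_left, Rmax_right by lra; intros Hx.
now apply continuous_expweight, H.
Qed.

Lemma is_RInt_piece_ext p t k (F G : R -> R) : t k <= t (k + 1)%nat ->
  (forall x, t k <= x <= t (k + 1)%nat -> continuous F x) ->
  (forall x, t k < x < t (k + 1)%nat -> G x = F x) ->
  is_RInt (fun x => G x * exp (p * x)) (t k) (t (k + 1)%nat) (piece p t k F).
Proof.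
intros Ht H E; apply is_RInt_eq with (fun x => F x * exp (p * x)) (piece p t k F);
  [now apply is_RInt_piece| |reflexivity].
intros x; rewrite Rmin_left, Rmax_right by lra; intros Hx; now rewrite E.
Qed.

Lemma continuous_mult_R (f g : R -> R) x :
  continuous f x -> continuous g x -> continuous (fun y : R => f y * g y) x.
Proof. apply (continuous_mult f g). Qed.

Lemma ip_hat_diag p lam0 lam1 t n i : increasing_knots t n -> (1 <= i <= n)%nat ->
  ip p (t 1%nat) (t n) (hat lam0 lam1 t n i) (hat lam0 lam1 t n i) = diag p lam0 lam1 t n i.
Proof.
intros Ht Hi; apply is_RInt_unique; unfold diag; apply is_RInt_hat; auto.
- now intros ->.
- intros ->; now rewrite Nat.eqb_refl.
- intros k -> Hk; assert (Hkt := Ht k Hk).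
  destruct (Nat.eqb_spec (k + 1) 1); [lia|]; replace (k + 1 - 1)%nat with k by lia.
  apply is_RInt_piece_ext; [lra| |].
  + intros; apply continuous_mult_R; apply continuous_lramp.
  + intros; rewrite hat_left by (auto; lra); reflexivity.
- intros Hk; assert (Hkt := Ht i ltac:(lia)).
  destruct (Nat.eqb_spec i n); [lia|].
  apply is_RInt_piece_ext; [lra| |].
  + intros; apply continuous_mult_R; apply continuous_rramp.
  + intros; rewrite hat_right by (lia || lra); reflexivity.
Qed.

Lemma ip_hat_next p lam0 lam1 t n k : increasing_knots t n -> (1 <= k <= n - 1)%nat ->
  ip p (t 1%nat) (t n) (hat lam0 lam1 t n k) (hat lam0 lam1 t n (k + 1)) = gramC p lam0 lam1 t k.
Proof.
intros Ht Hk; apply is_RInt_unique.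
replace (gramC _ _ _ _ _) with (gramC p lam0 lam1 t k + 0) by ring.
assert (Hkt := Ht k Hk).
apply is_RInt_hat; auto; try lia.
- intros k' Hk' _; replace k' with k by lia.
  apply is_RInt_piece_ext; [lra| |].
  + intros; apply continuous_mult_R; [apply continuous_lramp|apply continuous_rramp].
  + intros; rewrite hat_right by (lia || lra); ring.
- intros Hk1; assert (Hkt1 := Ht (k + 1)%nat ltac:(lia)); apply is_RInt_zero; [lra|].
  intros x Hx; rewrite (hat_zero_piece _ _ _ _ k (k + 1)) by (auto; lia); ring.
Qed.

(** The value is the defect of row [i] of the normal equations. It serves twice: a solution of the
    system yields a projection, and the coefficients of any projection solve the system. *)
Lemma is_RInt_residual p lam0 lam1 t n (f g : R -> R) (a : nat -> R) i :
  increasing_knots t n -> (1 <= i <= n)%nat ->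
  (forall x, t 1%nat <= x <= t n -> continuous f x) ->
  (forall x, t 1%nat <= x <= t n ->
     g x = sum_n_m (fun j => a j * hat lam0 lam1 t n j x) 1 n) ->
  is_RInt (fun x => (f x - g x) * hat lam0 lam1 t n i x * exp (p * x)) (t 1%nat) (t n)
    (load p lam0 lam1 t n f i -
     (lower p lam0 lam1 t i * a (i - 1)%nat + diag p lam0 lam1 t n i * a i +
      upper p lam0 lam1 t n i * a (i + 1)%nat)).
Proof.
intros Ht Hi Hf Hg.
(* Inside this proof [R] now names the falling ramps, so the type of reals is written
   [Rdefinitions.R]. *)
pose (L := lramp lam0 lam1 t); pose (R := rramp lam0 lam1 t).
assert (P : forall k (q : Rdefinitions.R -> Rdefinitions.R), (1 <= k <= n - 1)%nat ->
  (forall x, continuous q x) ->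
  is_RInt (fun x => (f x - g x) * q x * exp (p * x)) (t k) (t (k + 1)%nat)
    (1 * piece p t k (fun x => f x * q x) +
     -1 * (a k * piece p t k (fun x => R k x * q x) +
           a (k + 1)%nat * piece p t k (fun x => L k x * q x)))).
{ intros k q Hk Hq; assert (Hkt := Ht k Hk).
  assert (Q1 := knots_le t n 1 k Ht ltac:(lia) ltac:(lia) ltac:(lia)).
  assert (Q2 := knots_le t n (k + 1) n Ht ltac:(lia) ltac:(lia) ltac:(lia)).
  eapply is_RInt_eq; [apply is_RInt_lin; [|apply is_RInt_lin]; apply is_RInt_piece| |reflexivity];
    try lra.
  - intros; apply continuous_mult_R; auto; apply Hf; lra.
  - intros; apply continuous_mult_R; auto; apply continuous_rramp.
  - intros; apply continuous_mult_R; auto; apply continuous_lramp.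
  - intros x; rewrite Rmin_left, Rmax_right by lra; intros Hx.
    rewrite Hg, (sum_hat_piece _ _ _ _ _ k) by (auto; lra); fold (L k) (R k); ring. }
pose (lI := if Nat.eqb i 1 then 0 else
  1 * piece p t (i - 1) (fun x => f x * L (i - 1)%nat x) +
  -1 * (a (i - 1)%nat * piece p t (i - 1) (fun x => R (i - 1)%nat x * L (i - 1)%nat x) +
        a i * piece p t (i - 1) (fun x => L (i - 1)%nat x * L (i - 1)%nat x))).
pose (rI := if Nat.eqb i n then 0 else
  1 * piece p t i (fun x => f x * R i x) +
  -1 * (a i * piece p t i (fun x => R i x * R i x) +
        a (i + 1)%nat * piece p t i (fun x => L i x * R i x))).
replace (_ - _) with (lI + rI).
- apply is_RInt_hat; auto.
  + intros E; unfold lI; now rewrite E.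
  + intros E; unfold rI; now rewrite E, Nat.eqb_refl.
  + intros k -> Hk; unfold lI.
    destruct (Nat.eqb_spec (k + 1) 1); [lia|]; replace (k + 1 - 1)%nat with k by lia.
    apply P; auto; intros; apply continuous_lramp.
  + intros Hk; unfold rI; destruct (Nat.eqb_spec i n); [lia|].
    apply P; [lia|]; intros; apply continuous_rramp.
- assert (S : forall k, piece p t k (fun x => R k x * L k x) = gramC p lam0 lam1 t k).
  { intros k; apply RInt_eq_R; intros x _; unfold L, R; ring. }
  unfold lI, rI; rewrite S; unfold load, lower, diag, upper, gramC, gramL, gramR.
  fold L R; destruct (Nat.eqb i 1); destruct (Nat.eqb i n); ring.
Qed.

Lemma ramp_ge_0 a b u v x : u < v -> u <= x <= v -> 0 <= ramp a b u v x /\ 0 <= ramp a b v u x.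
Proof.
intros H Hx; unfold ramp, Rdiv; split.
- assert (P := Rinv_0_lt_compat _ (fund2_pos a b (v - u) ltac:(lra))).
  apply Rmult_le_pos; [|lra].
  destruct (Req_dec (x - u) 0) as [->|]; [rewrite fund2_0; lra|left; apply fund2_pos; lra].
- assert (P := Rinv_lt_0_compat _ (fund2_neg a b (u - v) ltac:(lra))).
  assert (Q : fund2 a b (x - v) <= 0).
  { destruct (Req_dec (x - v) 0) as [->|]; [rewrite fund2_0; lra|left; apply fund2_neg; lra]. }
  nra.
Qed.

Lemma gram_pos p lam0 lam1 t k : t k < t (k + 1)%nat ->
  0 < gramL p lam0 lam1 t k /\ 0 < gramR p lam0 lam1 t k.
Proof. apply RInt_ramp_sq_pos. Qed.

(** The mixed integral is symmetric in the two ramps, so it compares with either square: positive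
    step for [gramL], negative step for [gramR]. *)
Lemma gramC_eq p lam0 lam1 t k : t k < t (k + 1)%nat ->
  gramC p lam0 lam1 t k =
    Tp p (lam0 k) (lam1 k) (t (k + 1)%nat - t k) * gramL p lam0 lam1 t k /\
  gramC p lam0 lam1 t k =
    Tp p (lam0 k) (lam1 k) (t k - t (k + 1)%nat) * gramR p lam0 lam1 t k.
Proof.
intros H; split; [apply RInt_ramp_cross; lra|].
assert (E := RInt_ramp_cross (lam0 k) (lam1 k) p (t (k + 1)%nat) (t k) ltac:(lra)).
(* With the knots exchanged both integrals run backwards; turning them round puts one sign on each
   side. *)
rewrite RInt_swap_R, (RInt_swap_R _ (t (k + 1)%nat) (t k)) in E.
- apply Ropp_eq_reg; unfold gramC, piece, gramR, rramp, lramp.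
  rewrite Ropp_mult_distr_r; etransitivity; [|exact E].
  f_equal; apply RInt_eq_R; intros; ring.
- intros; apply continuous_expweight, continuous_mult_R; apply continuous_ramp.
- intros; apply continuous_expweight, continuous_mult_R; apply continuous_ramp.
Qed.

Lemma piece_ramp_eq p lam0 lam1 t k : t k < t (k + 1)%nat ->
  piece p t k (lramp lam0 lam1 t k) =
    Sp p (lam0 k) (lam1 k) (t (k + 1)%nat - t k) * gramL p lam0 lam1 t k /\
  piece p t k (rramp lam0 lam1 t k) =
    Sp p (lam0 k) (lam1 k) (t k - t (k + 1)%nat) * gramR p lam0 lam1 t k.
Proof.
intros H; split; [apply RInt_ramp; lra|].
assert (E := RInt_ramp (lam0 k) (lam1 k) p (t (k + 1)%nat) (t k) ltac:(lra)).
rewrite RInt_swap_R, (RInt_swap_R _ (t (k + 1)%nat) (t k)) in E.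
- apply Ropp_eq_reg; rewrite Ropp_mult_distr_r; exact E.
- intros; apply continuous_expweight, continuous_mult_R; apply continuous_ramp.
- intros; apply continuous_expweight; apply continuous_ramp.
Qed.

Lemma Rabs_piece_mult_le p t k (f q : R -> R) M : t k <= t (k + 1)%nat ->
  (forall x, t k <= x <= t (k + 1)%nat ->
     continuous f x /\ continuous q x /\ Rabs (f x) <= M /\ 0 <= q x) ->
  Rabs (piece p t k (fun x => f x * q x)) <= M * piece p t k q.
Proof.
intros Ht H.
apply (norm_RInt_le (V := R_NormedModule) (fun x => f x * q x * exp (p * x))
  (fun x => M * (q x * exp (p * x))) (t k) (t (k + 1)%nat)); auto.
- intros x Hx; destruct (H x Hx) as (_ & _ & Hf & Hq).
  unfold norm; simpl; unfold abs; simpl; rewrite !Rabs_mult.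
  rewrite (Rabs_pos_eq (q x)), (Rabs_pos_eq (exp _)) by (auto; left; apply exp_pos).
  rewrite Rmult_assoc; apply Rmult_le_compat_r; auto.
  apply Rmult_le_pos; auto; left; apply exp_pos.
- apply is_RInt_piece; auto; intros x Hx; destruct (H x Hx) as (? & ? & _).
  now apply continuous_mult_R.
- apply (is_RInt_scal (fun x => q x * exp (p * x))); apply is_RInt_piece; auto.
  intros x Hx; now destruct (H x Hx) as (? & ? & _).
Qed.

(** * The projection *)

Lemma Rabs_mult_le c x z : 0 < z -> Rabs x <= c -> Rabs (x * z) <= c * z.
Proof.
intros Hz Hx; rewrite Rabs_mult, (Rabs_pos_eq z) by lra.
apply Rmult_le_compat_r; lra.
Qed.

Lemma diag_pos p lam0 lam1 t n i : increasing_knots t n -> (2 <= n)%nat -> (1 <= i <= n)%nat ->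
  0 < diag p lam0 lam1 t n i.
Proof.
intros Ht Hn Hi; unfold diag.
destruct (Nat.eqb_spec i 1) as [E1|E1]; destruct (Nat.eqb_spec i n) as [E2|E2]; [lia|..].
- generalize (gram_pos p lam0 lam1 t i (Ht i ltac:(lia))); lra.
- generalize (gram_pos p lam0 lam1 t (i - 1) (Ht (i - 1)%nat ltac:(lia))); lra.
- generalize (gram_pos p lam0 lam1 t i (Ht i ltac:(lia)))
    (gram_pos p lam0 lam1 t (i - 1) (Ht (i - 1)%nat ltac:(lia))); lra.
Qed.

(** The left neighbour is charged to [gramL] of the left interval and the right one to [gramR] of
    the right interval; the diagonal entry is the sum of exactly these two. *)
Lemma row_dominant p lam0 lam1 t n c i : increasing_knots t n -> (1 <= i <= n)%nat ->
  (forall k, (1 <= k <= n - 1)%nat ->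
     Rabs (Tp p (lam0 k) (lam1 k) (t (k + 1)%nat - t k)) <= c /\
     Rabs (Tp p (lam0 k) (lam1 k) (t k - t (k + 1)%nat)) <= c) ->
  Rabs (lower p lam0 lam1 t i) + Rabs (upper p lam0 lam1 t n i) <= c * diag p lam0 lam1 t n i.
Proof.
intros Ht Hi HT; unfold lower, upper, diag; rewrite Rmult_plus_distr_l.
apply Rplus_le_compat.
- destruct (Nat.eqb_spec i 1); [rewrite Rabs_R0; lra|].
  assert (Hk : (1 <= i - 1 <= n - 1)%nat) by lia.
  rewrite (proj1 (gramC_eq p lam0 lam1 t (i - 1) (Ht _ Hk))).
  apply Rabs_mult_le; [exact (proj1 (gram_pos p lam0 lam1 t (i - 1) (Ht _ Hk))) | exact (proj1 (HT _ Hk))].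
- destruct (Nat.eqb_spec i n); [rewrite Rabs_R0; lra|].
  assert (Hk : (1 <= i <= n - 1)%nat) by lia.
  rewrite (proj2 (gramC_eq p lam0 lam1 t i (Ht _ Hk))).
  apply Rabs_mult_le; [exact (proj2 (gram_pos p lam0 lam1 t i (Ht _ Hk))) | exact (proj2 (HT _ Hk))].
Qed.

(** The pieces are nonnegative, so each integral against [f] is at most [M] times the integral of
    the piece, which [Sp] compares with its square. *)
Lemma Rabs_load_le p lam0 lam1 t n c M (f : R -> R) i : increasing_knots t n ->
  (1 <= i <= n)%nat -> 0 <= M ->
  (forall x, t 1%nat <= x <= t n -> continuous f x /\ Rabs (f x) <= M) ->
  (forall k, (1 <= k <= n - 1)%nat ->
     Rabs (Sp p (lam0 k) (lam1 k) (t (k + 1)%nat - t k)) <= c /\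
     Rabs (Sp p (lam0 k) (lam1 k) (t k - t (k + 1)%nat)) <= c) ->
  Rabs (load p lam0 lam1 t n f i) <= M * c * diag p lam0 lam1 t n i.
Proof.
intros Ht Hi HM Hf HS; unfold load, diag; rewrite Rmult_plus_distr_l.
assert (P : forall k, (1 <= k <= n - 1)%nat ->
  Rabs (piece p t k (fun x => f x * lramp lam0 lam1 t k x)) <= M * c * gramL p lam0 lam1 t k /\
  Rabs (piece p t k (fun x => f x * rramp lam0 lam1 t k x)) <= M * c * gramR p lam0 lam1 t k).
{ intros k Hk; assert (Hkt := Ht k Hk).
  assert (Q1 := knots_le t n 1 k Ht ltac:(lia) ltac:(lia) ltac:(lia)).
  assert (Q2 := knots_le t n (k + 1) n Ht ltac:(lia) ltac:(lia) ltac:(lia)).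
  destruct (gram_pos p lam0 lam1 t k Hkt) as [PL PR].
  destruct (piece_ramp_eq p lam0 lam1 t k Hkt) as [EL ER].
  destruct (HS k Hk) as [SL SR].
  rewrite !Rmult_assoc.
  split; (eapply Rle_trans; [apply (Rabs_piece_mult_le _ _ _ _ _ M); [lra|]|]).
  - intros x Hx; destruct (Hf x ltac:(lra)); repeat split; auto.
    + apply continuous_lramp.
    + exact (proj1 (ramp_ge_0 (lam0 k) (lam1 k) _ _ x Hkt Hx)).
  - apply Rmult_le_compat_l; auto.
    rewrite EL; eapply Rle_trans; [apply Rle_abs|now apply Rabs_mult_le].
  - intros x Hx; destruct (Hf x ltac:(lra)); repeat split; auto.
    + apply continuous_rramp.
    + exact (proj2 (ramp_ge_0 (lam0 k) (lam1 k) _ _ x Hkt Hx)).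
  - apply Rmult_le_compat_l; auto.
    rewrite ER; eapply Rle_trans; [apply Rle_abs|now apply Rabs_mult_le]. }
eapply Rle_trans; [apply Rabs_triang|]; apply Rplus_le_compat.
- destruct (Nat.eqb_spec i 1); [rewrite Rabs_R0; lra|].
  exact (proj1 (P (i - 1)%nat ltac:(lia))).
- destruct (Nat.eqb_spec i n); [rewrite Rabs_R0; lra|].
  exact (proj2 (P i ltac:(lia))).
Qed.

(** The choice by [epsilon] is meaningful once a projection exists; with positive diagonal and
    [c < 1] the normal equations are strictly dominant, hence solvable. *)
Lemma Pproj_spec p lam0 lam1 t n c (f : R -> R) : increasing_knots t n -> (2 <= n)%nat -> c < 1 ->
  (forall i, (1 <= i <= n)%nat ->
     Rabs (lower p lam0 lam1 t i) + Rabs (upper p lam0 lam1 t n i) <=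
     c * diag p lam0 lam1 t n i) ->
  (forall x, t 1%nat <= x <= t n -> continuous f x) ->
  is_proj p lam0 lam1 t n f (Pproj p lam0 lam1 t n f).
Proof.
intros Ht Hn Hc HD Hf; unfold Pproj; apply epsilon_spec.
destruct (tridiagonal_solvable n (lower p lam0 lam1 t) (diag p lam0 lam1 t n)
  (upper p lam0 lam1 t n) (load p lam0 lam1 t n f)) as [a Ha].
{ intros i Hi; eapply Rle_lt_trans; [now apply HD|].
  generalize (diag_pos p lam0 lam1 t n i Ht Hn Hi); nra. }
exists (fun x => sum_n_m (fun j => a j * hat lam0 lam1 t n j x) 1 n); split.
- now exists a.
- intros i Hi; apply is_RInt_unique; rewrite <- (Rminus_diag (load p lam0 lam1 t n f i)).
  rewrite <- (Ha i Hi) at 2; now apply is_RInt_residual.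
Qed.

Lemma Rabs_sum_n_m_le (u v : nat -> R) K n : 
  (forall j, (1 <= j <= n)%nat -> Rabs (u j) <= K) ->
  Rabs (sum_n_m (fun j => u j * v j) 1 n) <= K * sum_n_m (fun j => Rabs (v j)) 1 n.
Proof.
intros H; induction n as [|n IH].
- rewrite !sum_n_m_eq_0 by (intros; lia); rewrite Rabs_R0; lra.
- destruct (Nat.eq_dec n 0) as [->|Hn].
  + rewrite !sum_n_n, Rabs_mult; apply Rmult_le_compat_r; [apply Rabs_pos|now apply H].
  + rewrite !sum_n_Sm by lia; unfold plus; simpl.
    eapply Rle_trans; [apply Rabs_triang|]; rewrite Rmult_plus_distr_l.
    apply Rplus_le_compat; [apply IH; intros; apply H; lia|].
    rewrite Rabs_mult; apply Rmult_le_compat_r; [apply Rabs_pos|apply H; lia].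
Qed.

Lemma sum_n_m_le_INR (v : nat -> R) n :
  (forall j, v j <= 1) -> sum_n_m v 1 n <= INR n.
Proof.
intros H; eapply Rle_trans; [apply (sum_n_m_le v (fun _ => 1)); auto|].
rewrite sum_n_m_const; replace (S n - 1)%nat with n by lia; lra.
Qed.

Lemma supnorm_Pproj_le p lam0 lam1 t n c S0 Lam (f : R -> R) :
  increasing_knots t n -> (2 <= n)%nat -> 0 <= c < 1 ->
  (forall k, (1 <= k <= n - 1)%nat ->
     Rabs (Tp p (lam0 k) (lam1 k) (t (k + 1)%nat - t k)) <= c /\
     Rabs (Tp p (lam0 k) (lam1 k) (t k - t (k + 1)%nat)) <= c) ->
  (forall k, (1 <= k <= n - 1)%nat ->
     Rabs (Sp p (lam0 k) (lam1 k) (t (k + 1)%nat - t k)) <= S0 /\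
     Rabs (Sp p (lam0 k) (lam1 k) (t k - t (k + 1)%nat)) <= S0) ->
  (forall x, t 1%nat <= x <= t n ->
     sum_n_m (fun j => Rabs (hat lam0 lam1 t n j x)) 1 n <= Lam) ->
  (forall x, t 1%nat <= x <= t n -> continuous f x) ->
  supnorm (t 1%nat) (t n) (Pproj p lam0 lam1 t n f) <=
  Lam * (S0 / (1 - c)) * supnorm (t 1%nat) (t n) f.
Proof.
intros Ht Hn Hc HT HS HL Hf.
assert (Htn := knots_le t n 1 n Ht ltac:(lia) ltac:(lia) ltac:(lia)).
assert (HD : forall i, (1 <= i <= n)%nat ->
     Rabs (lower p lam0 lam1 t i) + Rabs (upper p lam0 lam1 t n i) <=
     c * diag p lam0 lam1 t n i) by (intros; now apply row_dominant).
set (M := supnorm (t 1%nat) (t n) f).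
assert (HfM : forall x, t 1%nat <= x <= t n -> Rabs (f x) <= M)
  by (intros; now apply le_supnorm).
assert (HM : 0 <= M) by (generalize (HfM (t 1%nat) ltac:(lra)) (Rabs_pos (f (t 1%nat))); lra).
destruct (Pproj_spec p lam0 lam1 t n c f Ht Hn (proj2 Hc) HD Hf) as [[a Ha] Horth].
assert (HS0 : 0 <= S0).
{ destruct (HS 1%nat ltac:(lia)) as [Q _]; eapply Rle_trans; [apply Rabs_pos|exact Q]. }
assert (HaM : forall j, (1 <= j <= n)%nat -> Rabs (a j) <= M * S0 / (1 - c)).
{ apply (tridiagonal_bound n (lower p lam0 lam1 t) (diag p lam0 lam1 t n)
    (upper p lam0 lam1 t n) (load p lam0 lam1 t n f)).
  - apply Hc.
  - reflexivity.
  - unfold upper; now rewrite Nat.eqb_refl.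
  - intros i Hi; repeat split.
    + now apply diag_pos.
    + now apply HD.
    + apply Rabs_load_le; auto.
    (* Orthogonality to hat [i] says that the defect of row [i] is 0. *)
    + assert (I := is_RInt_unique (V := R_CompleteNormedModule) _ _ _ _
        (is_RInt_residual p lam0 lam1 t n f _ a i Ht Hi Hf Ha)).
      specialize (Horth i Hi); unfold ip in Horth; lra. }
apply supnorm_le; [lra|]; intros x Hx; rewrite Ha by auto.
eapply Rle_trans; [apply Rabs_sum_n_m_le, HaM|].
replace (Lam * (S0 / (1 - c)) * M) with (M * S0 / (1 - c) * Lam) by (field; lra).
apply Rmult_le_compat_l; auto.
apply Rmult_le_pos; [now apply Rmult_le_pos|].
left; apply Rinv_0_lt_compat; lra.
Qed.

(** For an infinite [Ssup] the norm bound would be infinite, so it is stated for a finite value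
    [S0]. *)
Theorem mainTheorem14 (delta p : R) (n : nat) (lam0 lam1 : nat -> R) :
  0 < delta -> (3 <= n)%nat ->
  (forall j, (1 <= j <= n - 1)%nat -> lam0 j <= lam1 j) ->
  (forall j, (1 <= j <= n - 1)%nat -> forall x y, - delta <= x -> x < y -> y <= delta ->
       phi lam0 lam1 j x < phi lam0 lam1 j y) ->
  let c := Lub_Rbar (fun y => exists h j, 0 < Rabs h <= delta /\ (1 <= j <= n - 1)%nat /\
                        y = Rabs (Tp p (lam0 j) (lam1 j) h)) in
  let Ssup := Lub_Rbar (fun y => exists h j, 0 < Rabs h <= delta /\ (1 <= j <= n - 1)%nat /\
                        y = Rabs (Sp p (lam0 j) (lam1 j) h)) in
  Rbar_lt c (Finite 1) ->
  forall t : nat -> R,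
    (forall j, (1 <= j <= n - 1)%nat -> t j < t (j + 1)%nat /\ t (j + 1)%nat - t j <= delta) ->
    let s := fun i j => ip p (t 1%nat) (t n) (hat lam0 lam1 t n i) (hat lam0 lam1 t n j) in
    (forall j, (1 <= j <= n)%nat ->
       (if Nat.eqb j 1 then 0 else Rabs (s (j - 1)%nat j)) +
       (if Nat.eqb j n then 0 else Rabs (s j (j + 1)%nat))
       <= real c * Rabs (s j j)) /\
    (forall S0, Ssup = Finite S0 ->
       Rbar_le (opnorm p lam0 lam1 t n)
         (Finite (real (Lub_Rbar (fun y => exists x, t 1%nat <= x <= t n /\
                     y = sum_n_m (fun j => Rabs (hat lam0 lam1 t n j x)) 1 n))
                  * (S0 / (1 - real c))))).
Proof.
intros Hd Hn _ Hphi c Ssup Hc t Hmesh s.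
assert (Ht : increasing_knots t n) by (intros k Hk; now apply Hmesh).
assert (Hh : forall k, (1 <= k <= n - 1)%nat ->
  0 < Rabs (t (k + 1)%nat - t k) <= delta /\ 0 < Rabs (t k - t (k + 1)%nat) <= delta).
{ intros k Hk; destruct (Hmesh k Hk); rewrite (Rabs_minus_sym (t k)), Rabs_pos_eq; lra. }
assert (HTc : forall h j, 0 < Rabs h <= delta -> (1 <= j <= n - 1)%nat ->
  Rbar_le (Rabs (Tp p (lam0 j) (lam1 j) h)) c).
{ intros h j H1 H2; apply (proj1 (Lub_Rbar_correct _)); now exists h, j. }
assert (Hc1 : 0 <= real c < 1 /\ forall h j, 0 < Rabs h <= delta -> (1 <= j <= n - 1)%nat ->
  Rabs (Tp p (lam0 j) (lam1 j) h) <= real c).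
(* A least upper bound of a nonempty set of absolute values is nonnegative; being also below 1, [c]
   is finite and [real c] is the true supremum. *)
{ assert (Q : Rbar_le 0 c).
  { eapply Rbar_le_trans; [|apply (HTc delta 1%nat)]; [apply Rabs_pos| |lia].
    rewrite Rabs_pos_eq; lra. }
  destruct c as [c| |]; simpl in *; try easy; auto. }
destruct Hc1 as [Hc1 HT].
assert (HT' : forall k, (1 <= k <= n - 1)%nat ->
     Rabs (Tp p (lam0 k) (lam1 k) (t (k + 1)%nat - t k)) <= real c /\
     Rabs (Tp p (lam0 k) (lam1 k) (t k - t (k + 1)%nat)) <= real c).
{ intros k Hk; split; apply HT; auto; now apply Hh. }
split.
- intros j Hj; unfold s; rewrite ip_hat_diag by auto.
  rewrite (Rabs_pos_eq (diag _ _ _ _ _ _)) by (left; apply diag_pos; auto; lia).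
  eapply Rle_trans; [|apply (row_dominant p lam0 lam1 t n (real c) j); auto].
  apply Req_le; unfold lower, upper; f_equal.
  + destruct (Nat.eqb_spec j 1); [now rewrite Rabs_R0|].
    replace j with (j - 1 + 1)%nat at 2 by lia; rewrite ip_hat_next by (auto; lia); auto.
  + destruct (Nat.eqb_spec j n); [now rewrite Rabs_R0|].
    rewrite ip_hat_next by (auto; lia); auto.
- intros S0 HS0; apply Lub_Rbar_correct; intros y (f & Hf & Hf0 & ->).
  assert (HS : forall h j, 0 < Rabs h <= delta -> (1 <= j <= n - 1)%nat ->
    Rabs (Sp p (lam0 j) (lam1 j) h) <= S0).
  { intros h j H1 H2; change (Rbar_le (Rabs (Sp p (lam0 j) (lam1 j) h)) S0); rewrite <- HS0.
    apply (proj1 (Lub_Rbar_correct _)); now exists h, j. }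
  assert (Htn := knots_le t n 1 n Ht ltac:(lia) ltac:(lia) ltac:(lia)).
  set (Lam := real _).
  assert (M : 0 < supnorm (t 1%nat) (t n) f).
  { generalize (le_supnorm _ _ f (t 1%nat) Hf ltac:(lra)) (Rabs_pos (f (t 1%nat))); lra. }
  simpl; apply Rmult_le_reg_r with (supnorm (t 1%nat) (t n) f); auto.
  unfold Rdiv at 1; rewrite Rmult_assoc, Rinv_l, Rmult_1_r by auto.
  apply supnorm_Pproj_le; auto; try lia.
  + intros k Hk; split; apply HS; auto; now apply Hh.
  (* Each absolute hat is at most 1, so the sum is bounded by [INR n] and [Lam] is a genuine
     supremum. *)
  + intros x Hx.
    apply (Lub_Rbar_le_real (fun y => exists x, t 1%nat <= x <= t n /\
        y = sum_n_m (fun j => Rabs (hat lam0 lam1 t n j x)) 1 n) (INR n)).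
    * now exists (sum_n_m (fun j => Rabs (hat lam0 lam1 t n j x)) 1 n), x.
    * intros z (w & _ & ->); apply sum_n_m_le_INR; intros j.
      now apply Rabs_hat_le_1 with delta.
    * now exists x.
Qed.
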